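(* Let $\Omega \subset \mathbb{R}^d$ be a strictly convex bounded domain, let $0\leq \alpha < 1$, $0 < \epsilon < 1-\alpha$, and let $\lambda,\beta$ be real numbers such that $$1 \leq \beta < \frac{\log(1/\alpha)}{\log\big(1/(1-\epsilon)\big)}, \qquad 0 < \lambda < \min\Big\{\epsilon, \frac{1}{\beta}\Big\}\Big(\frac{2}{\operatorname{diam}(\Omega)}\Big)^{\beta-1}.$$ Suppose that $r:\Omega\to(0,+\infty)$ is an admissible radius function in $\Omega$ satisfying $|r(x)-r(y)|\leq |x-y|$ for all $x,y\in\Omega$, together with $$\lambda\, \operatorname{dist}(x,\partial\Omega)^{\beta} \leq r(x) \leq \epsilon\, \operatorname{dist}(x,\partial\Omega) \quad \text{for all } x\in\Omega.$$ Let $S$, $M$ be the operators associated to $r$ and to $d$-dimensional Lebesgue measure $\mu=m$, and $T_\alpha = \alpha S + (1-\alpha)M$. Then for every $f\in C(\partial\Omega)$ the Dirichlet problem $$T_\alpha u = u \ \text{ in } \Omega, \qquad u = f \ \text{ on } \partial\Omega$$ has a unique solution $\widetilde{u}\in C(\overline{\Omega})$. Furthermore, if $u_0\in C(\overline{\Omega})$ is any continuous extension of $f$ to $\overline{\Omega}$, then $H_\alpha^k u_0 \to \widetilde{u}$ uniformly in $\overline{\Omega}$ as $k\to\infty$, where $H_\alpha = \frac12(I+T_\alpha)$ and $H_\alpha^k$ denotes its $k$-th iterate.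
   Context: A bounded convex domain is strictly convex if for any $x,y\in\partial\Omega$ the open segment $(x,y)$ is contained in $\Omega$. A function $r:\Omega\to(0,+\infty)$ is an admissible radius function in $\Omega$ if $0<r(x)\leq \operatorname{dist}(x,\partial\Omega)$ for all $x\in\Omega$; write $B_x = B(x,r(x))$ for the open ball. For a positive measure $\mu$ on $\mathbb{R}^d$ and $u\in C(\overline{\Omega})$, define for $x\in\Omega$: $Su(x) = \frac12\big(\sup_{B_x}u + \inf_{B_x}u\big)$ and $Mu(x) = \frac{1}{\mu(B_x)}\int_{B_x} u\,d\mu$. When $\alpha=0$, $\log(1/\alpha)=+\infty$, so the upper bound on $\beta$ is vacuous. *)

(* Defs.v *)
From HB Require Import structures.
From mathcomp Require Import all_boot all_order all_algebra.
From mathcomp Require Import all_classical all_reals all_analysis.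
Set Implicit Arguments. Unset Strict Implicit. Unset Printing Implicit Defensive.
Import Order.TTheory GRing.Theory Num.Theory.
Import numFieldNormedType.Exports.
Local Open Scope classical_set_scope.
Local Open Scope ring_scope.

Section Defs.
Variable R : realType.

Definition enorm (d : nat) (x : 'rV[R]_d) : R :=
  Num.sqrt (\sum_(i < d) x ord0 i ^+ 2).

Definition eball (d : nat) (x : 'rV[R]_d) (rho : R) : set 'rV[R]_d :=
  [set y | enorm (y - x) < rho].

Definition is_domain (d : nat) (O : set 'rV[R]_d) : Prop :=
  open O /\ connected O /\ O !=set0.

Definition ebounded (d : nat) (O : set 'rV[R]_d) : Prop :=
  exists M : R, forall x, O x -> enorm x <= M.

Definition convex_set (d : nat) (O : set 'rV[R]_d) : Prop :=
  forall x y, O x -> O y -> forall t : R, 0 <= t <= 1 -> O ((1 - t) *: x + t *: y).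

Definition bdry (d : nat) (O : set 'rV[R]_d) : set 'rV[R]_d :=
  closure O `\` interior O.

Definition strictly_convex (d : nat) (O : set 'rV[R]_d) : Prop :=
  convex_set O /\
  forall x y, bdry O x -> bdry O y -> x != y ->
    forall t : R, 0 < t < 1 -> O ((1 - t) *: x + t *: y).

Definition dist_to (d : nat) (A : set 'rV[R]_d) (x : 'rV[R]_d) : R :=
  inf [set enorm (x - y) | y in A].

Definition diam (d : nat) (O : set 'rV[R]_d) : R :=
  sup [set enorm (x - y) | x in O & y in O].

(* d-dimensional Lebesgue integral, as the iterated one-dimensional
   Lebesgue integral (x = (t, y) with t in R, y in R^(d-1)) *)
Fixpoint iint (d : nat) : ('rV[R]_d -> R) -> R :=
  match d with
  | 0 => fun g => g 0
  | n.+1 => fun g =>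
      Rintegral (@lebesgue_measure R) setT
        (fun t : R => iint (fun y : 'rV[R]_n => g (row_mx (const_mx t : 'rV[R]_1) y)))
  end.

Definition ind (d : nat) (A : set 'rV[R]_d) (x : 'rV[R]_d) : R :=
  if x \in A then 1 else 0.

Definition leb_int (d : nat) (A : set 'rV[R]_d) (u : 'rV[R]_d -> R) : R :=
  iint (fun x => u x * ind A x).

Definition leb_meas (d : nat) (A : set 'rV[R]_d) : R := leb_int A (fun _ => 1).

Definition Sop (d : nat) (r : 'rV[R]_d -> R) (u : 'rV[R]_d -> R) (x : 'rV[R]_d) : R :=
  (sup (u @` eball x (r x)) + inf (u @` eball x (r x))) / 2.

Definition Mop (d : nat) (r : 'rV[R]_d -> R) (u : 'rV[R]_d -> R) (x : 'rV[R]_d) : R :=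
  leb_int (eball x (r x)) u / leb_meas (eball x (r x)).

Definition Top (d : nat) (alpha : R) (r : 'rV[R]_d -> R) (u : 'rV[R]_d -> R)
  (x : 'rV[R]_d) : R :=
  alpha * Sop r u x + (1 - alpha) * Mop r u x.

Definition Hop (d : nat) (O : set 'rV[R]_d) (alpha : R) (r : 'rV[R]_d -> R)
  (u : 'rV[R]_d -> R) (x : 'rV[R]_d) : R :=
  if x \in O then (u x + Top alpha r u x) / 2 else u x.

Definition Hiter (d : nat) (O : set 'rV[R]_d) (alpha : R) (r : 'rV[R]_d -> R)
  (k : nat) (u : 'rV[R]_d -> R) : 'rV[R]_d -> R :=
  iter k (Hop O alpha r) u.

Definition solves (d : nat) (O : set 'rV[R]_d) (alpha : R) (r : 'rV[R]_d -> R)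
  (f u : 'rV[R]_d -> R) : Prop :=
  {within closure O, continuous u} /\
  (forall x, O x -> Top alpha r u x = u x) /\
  (forall x, bdry O x -> u x = f x).

End Defs.

(* Main.v *)
(** The iterates need no equicontinuity estimate inside the domain: two orbits
    u_k = H^k u_0 and v_l = H^l v_0 with the same boundary values merge
    uniformly, by a half-relaxed limit argument.  Let w(x) be the upper limit of
    u_k(y) - v_l(y') as k, l tend to infinity and y, y' tend to x, let m be its
    maximum, and suppose m > 0.  At the boundary w vanishes: supporting affine
    functions are fixed by H and, by strict convexity, each of them touches the
    closure at a single point, so they are barriers for all iterates at once.
    At an interior point x with w(x) = m, the sup/inf part and the average part of
    T_alpha u_k - T_alpha v_l are at most m in the limit, and the average part,
    which has the positive weight 1 - alpha, is strictly smaller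
    unless w = m on the whole ball B_x.  Hence {w = m} is a compact subset of the
    domain containing B_x with each of its points x, which is absurd at a point
    where a coordinate is maximal.  Merging an orbit with itself gives
    convergence to a solution; merging it with the constant orbit of a solution
    gives uniqueness and convergence for every extension. *)
Require Import Defs.
From HB Require Import structures.
From mathcomp Require Import all_boot all_order all_algebra.
From mathcomp Require Import all_classical all_reals all_analysis.
From mathcomp Require Import measurable_realfun ring lra.
Set Implicit Arguments.
Unset Strict Implicit.
Unset Printing Implicit Defensive.
Import Order.TTheory GRing.Theory Num.Theory.
Import numFieldNormedType.Exports.
Local Open Scope classical_set_scope.
Local Open Scope ring_scope.

(** * Measurability of the iterated integral *)

Section IteratedIntegral.
Context {R : realType}.

Definition borel_rV (n : nat) := g_sigma_algebraType (@open 'rV[R]_n).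

Lemma open_measurable_rV n (A : set 'rV[R]_n) :
  open A -> measurable (A : set (borel_rV n)).
Proof. by move=> oA; apply: sub_sigma_algebra. Qed.

Lemma mx_norm_ltP m n (x : 'M[R]_(m, n)) (e : R) : 0 < e ->
  (forall i j, `|x i j| < e) -> `|x| < e.
Proof.
move=> e0 xe; have : ball (0 : 'M[R]_(m, n)) e x.
  by split => // i j; rewrite mxE -ball_normE /= sub0r normrN.
by rewrite -ball_normE /= sub0r normrN.
Qed.

Lemma mx_norm_leP m n (x : 'M[R]_(m, n)) (e : R) : 0 <= e ->
  (forall i j, `|x i j| <= e) -> `|x| <= e.
Proof.
move=> e0 xe; apply/ler_addgt0Pr => d d0; apply/ltW/mx_norm_ltP => [|i j].
  by rewrite ltr_wpDl.
by rewrite (le_lt_trans (xe i j)) // ltrDl.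
Qed.

Lemma le_coord_mx_norm m n (x : 'M[R]_(m, n)) i j : `|x i j| <= `|x|.
Proof.
rewrite leNgt; apply/negP => xij.
have : ball (0 : 'M[R]_(m, n)) `|x i j| x.
  by rewrite -ball_normE /= sub0r normrN.
by case=> _ /(_ i j); rewrite mxE -ball_normE /= sub0r normrN ltxx.
Qed.

Lemma rV_rat_approx n (y : 'rV[R]_n) (e : R) : 0 < e ->
  exists q : 'rV[rat]_n, `|map_mx ratr q - y| < e.
Proof.
move=> e0.
have /choice[f fP] (i : 'I_n) :
    exists q : rat, `|ratr q - y ord0 i| < e.
  have [|q] := @rat_in_itvoo R (y ord0 i - e) (y ord0 i + e); first lra.
  by rewrite in_itv/= => qP; exists q; rewrite ltr_norml; lra.
exists (\row_i f i); apply: mx_norm_ltP => // i j.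
by rewrite !mxE ord1.
Qed.

Let mR : measurableType _ := measurableTypeR R.

(** Second countability: an open set of the product is a countable union of products of balls with
    rational centres and radii 1/(k+1), each of which is a measurable rectangle. *)
Lemma open_measurable_prod n (A : set (R * 'rV[R]_n)) :
  open A -> measurable (A : set (mR * borel_rV n)).
Proof.
move=> oA.
pose B (p : rat * 'rV[rat]_n * nat) : set (R * 'rV[R]_n) :=
  ball (ratr p.1.1 : R) (p.2.+1%:R^-1) `*`
  ball (map_mx ratr p.1.2 : 'rV[R]_n) (p.2.+1%:R^-1).
pose F p := if `[< B p `<=` A >] then B p else set0.
suff -> : A = \bigcup_p F p.
  apply: countable_bigcupT_measurable => //.
  move=> p; rewrite /F; case: ifP => // _.
  apply: measurableX.
    exact: measurable_ball.
  apply: open_measurable_rV; exact: ball_open.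
apply/seteqP; split => [[t y] Aty|z [p _]]; last first.
  by rewrite /F; case: asboolP => // BA Bz; exact: BA.
have /nbhs_ballP[e /= e0 eA] : nbhs (t, y) A by exact: open_nbhs_nbhs.
(* With 2/(k+1) < e, a product of balls of radius 1/(k+1) whose centre is that close to (t, y) stays
   inside the [e]-ball around (t, y). *)
pose k := Num.trunc (2 / e).
have ke : 2 * k.+1%:R^-1 < e.
  rewrite ltr_pdivrMr // -ltr_pdivrMl // mulrC.
  by rewrite /k truncnS_gt.
have k0 : 0 < k.+1%:R^-1 :> R by rewrite invr_gt0.
pose w : R := k.+1%:R^-1; rewrite -/w in ke k0.
have [|q qP] := @rat_in_itvoo R (t - w) (t + w); first lra.
have [v vP] := rV_rat_approx y k0.
move: qP; rewrite in_itv/= => qP.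
exists (q, v, k) => //; rewrite /F /B /= -/w; case: asboolP => /= [_|].
  split; first by rewrite /ball/= ltr_norml; lra.
  by rewrite -ball_normE.
case=> -[s z] /= [].
rewrite -!ball_normE /= => qs vz; apply: eA; split => /=.
  rewrite -ball_normE /= ltr_norml.
  by move: qs; rewrite ltr_norml; lra.
rewrite -ball_normE /=.
have -> : y - z = (map_mx ratr v - z) - (map_mx ratr v - y) by rewrite opprB [RHS]addrC addrA subrK.
by rewrite (le_lt_trans (ler_normB _ _)) //; lra.
Qed.

(** The same term as in the recursion of [iint], so that sections of an integrand match it by
    conversion. *)
Definition consrV n (t : R) (y : 'rV[R]_n) : 'rV[R]_n.+1 :=
  row_mx (const_mx t : 'rV[R]_1) y.

Lemma consrVE n t (y : 'rV[R]_n) i j :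
  consrV t y i j = oapp (y ord0) t (unlift ord0 j).
Proof.
rewrite /consrV !mxE ord1; case: unliftP => [k ->|->] /=.
  case: splitP => k' /=; first by rewrite ord1.
  by case=> kk'; congr (y _ _); apply/val_inj.
by case: splitP => k /= // ; rewrite mxE.
Qed.

Lemma consrV_norm n t (y : 'rV[R]_n) :
  `|t| <= `|consrV t y| /\ `|y| <= `|consrV t y|.
Proof.
split.
  by have := le_coord_mx_norm (consrV t y) ord0 ord0; rewrite consrVE unlift_none.
apply: mx_norm_leP => // i j.
have := le_coord_mx_norm (consrV t y) ord0 (lift ord0 j).
by rewrite consrVE liftK /= (ord1 i).
Qed.

Lemma consrV_lipschitz n s t (y z : 'rV[R]_n) e : 0 < e ->
  `|s - t| < e -> `|y - z| < e -> `|consrV s y - consrV t z| < e.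
Proof.
move=> e0 st yz; apply: mx_norm_ltP => // i j; rewrite !mxE -/(consrV s y i j).
have := consrVE s y i j; have := consrVE t z i j; rewrite !mxE => -> ->.
case: unliftP => [k|] _ //=.
by rewrite (le_lt_trans _ yz) // (le_trans _ (le_coord_mx_norm (y - z) ord0 k)) // !mxE.
Qed.

Lemma measurable_consrV n :
  measurable_fun setT ((fun p => consrV p.1 p.2) : mR * borel_rV n -> borel_rV n.+1).
Proof.
apply: (@measurability _ _ (mR * borel_rV n)%type (borel_rV n.+1) setT _ (@open 'rV[R]_n.+1)) => //.
move=> _ [A oA <-]; rewrite setTI; apply: open_measurable_prod.
rewrite openE => -[t y] /= Aty; rewrite /interior.
have /nbhs_ballP[e /= e0 eA] : nbhs (consrV t y) A by exact: open_nbhs_nbhs.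
apply/nbhs_ballP; exists e => //= -[s z] [/=].
rewrite -!ball_normE /= => ts yz; apply: eA.
by rewrite -ball_normE /=; apply: consrV_lipschitz.
Qed.

(* The parameter space T is arbitrary so that the induction can move one
   coordinate at a time from the vector into the parameter. *)
Lemma measurable_iint n : forall d (T : measurableType d)
  (F : T * borel_rV n -> R), measurable_fun setT F ->
  measurable_fun setT (fun t => iint (fun y : 'rV[R]_n => F (t, y))).
Proof.
elim: n => [|n IH] d T F mF /=.
  by apply: (measurableT_comp mF); exact: measurable_fun_pair.
pose G (p : T * mR) := iint (fun y : 'rV[R]_n => F (p.1, consrV p.2 y)).
have mG : measurable_fun setT G.
  apply: (IH _ _ (fun q : (T * mR) * borel_rV n => F (q.1.1, consrV q.1.2 q.2))).
  apply: (measurableT_comp mF); apply: measurable_fun_pair => /=.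
    by apply: (measurableT_comp measurable_fst); exact: measurable_fst.
  have h : measurable_fun setT (fun x : (T * mR) * borel_rV n => (x.1.2 : mR, x.2)).
    apply: measurable_fun_pair => //=.
    by apply: (measurableT_comp measurable_snd); exact: measurable_fst.
  have := measurableT_comp (@measurable_consrV n) h.
  exact.
rewrite [X in measurable_fun _ X](_ : _ = fun t =>
  fine (\int[lebesgue_measure]_s (EFin \o G) (t, s))%E) //.
have mEG : measurable_fun setT (EFin \o G) by exact/measurable_EFinP.
apply: (@measurableT_comp _ _ _ _ _ _ (fine : \bar R -> R)) => //.
(* Positive and negative parts are treated separately by Tonelli, so that no integrability is
   required of [F]. *)
under eq_fun do rewrite integralE.
apply: emeasurable_funB.
  rewrite (_ : (fun t => _) = fubini_F lebesgue_measure (EFin \o G)^\+%E).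
    exact: (measurable_fun_fubini_tonelli_F _ (measurable_funepos mEG)).
  by apply: funext => t; apply: eq_integral => s _; rewrite !funeposE.
rewrite (_ : (fun t => _) = fubini_F lebesgue_measure (EFin \o G)^\-%E).
  exact: (measurable_fun_fubini_tonelli_F _ (measurable_funeneg mEG)).
by apply: funext => t; apply: eq_integral => s _; rewrite !funenegE.
Qed.

End IteratedIntegral.

(** * Linearity, positivity and affine changes of variable *)

Section OneDim.
Context {R : realType}.
Let mR : measurableType _ := measurableTypeR R.
Implicit Types (h : R -> R) (M L a b : R).

Lemma lebesgue_measure_itvcc (L : R) : 0 <= L ->
  @lebesgue_measure R `[- L, L] = (2 * L)%:E.
Proof.
move=> L0; rewrite lebesgue_measure_itv /= lte_fin.
case: ltP => LL; first by rewrite -EFinB; congr (_%:E); ring.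
by have -> : L = 0 by [lra|]; rewrite mulr0.
Qed.

Lemma integrable_bsupp h M L : 0 <= L -> measurable_fun [set: mR] h ->
  (forall t, `|h t| <= M) -> (forall t, L < `|t| -> h t = 0) ->
  (@lebesgue_measure R).-integrable [set: mR] (EFin \o h).
Proof.
move=> L0 mh hM hL; pose D : set R := `[- L, L]%classic.
have mD : measurable (D : set mR) by exact: measurable_itv.
have -> : EFin \o h = (EFin \o h) \_ D.
  apply: funext => t; rewrite patchE; case: ifPn => //.
  rewrite notin_setE /D /= in_itv /= -ler_norml => /negP.
  by rewrite -ltNge => /hL ->.
apply/(integrable_mkcond _ mD).
apply: measurable_bounded_integrable => //.
- by rewrite [X in (X < _)%E](lebesgue_measure_itvcc L0) ltry.
- exact: measurable_funTS.
- exists M; split; first exact: num_real.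
  by move=> y My x _ /=; rewrite (le_trans (hM x)) // ltW.
Qed.

Lemma Rintegral_bsupp_le h M L : 0 <= L -> measurable_fun [set: mR] h ->
  (forall t, `|h t| <= M) -> (forall t, L < `|t| -> h t = 0) ->
  `|Rintegral (@lebesgue_measure R) setT h| <= M * (2 * L).
Proof.
move=> L0 mh hM hL; pose D : set R := `[- L, L]%classic.
have mD : measurable (D : set mR) by exact: measurable_itv.
have ih := integrable_bsupp L0 mh hM hL.
have muD : fine ((@lebesgue_measure R) D) = 2 * L.
  by rewrite [X in fine X](lebesgue_measure_itvcc L0).
have -> : h = h \_ D.
  apply: funext => t; rewrite patchE; case: ifPn => //.
  rewrite notin_setE /D /= in_itv /= -ler_norml => /negP.
  by rewrite -ltNge => /hL ->.
rewrite -Rintegral_mkcond.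
have ihD : (@lebesgue_measure R).-integrable D (EFin \o h).
  exact: integrableS ih.
apply: (le_trans (le_normr_Rintegral mD ihD)).
rewrite -muD -Rintegral_cst //; apply: le_Rintegral => //.
  have := integrable_norm ihD; exact.
apply: measurable_bounded_integrable => //.
- by rewrite [X in (X < _)%E](lebesgue_measure_itvcc L0) ltry.
- exists `|M|; split; first exact: num_real.
  by move=> y My x _ /=; rewrite ltW.
Qed.

(** The push-forward is packed in an existential so that it is known only through its values and its
    integrals. *)
Lemma pushforward_lebesgue (phi : mR -> mR) : measurable_fun setT phi ->
  exists P : {measure set mR -> \bar R},
    (forall A, P A = (@lebesgue_measure R) (phi @^-1` A)) /\
    (forall f : mR -> \bar R, measurable_fun setT f -> (forall t, 0 <= f t)%E ->
      (\int[P]_t f t = \int[lebesgue_measure]_t f (phi t))%E).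
Proof.
move=> mphi; unshelve eexists.
  refine (pushforward (@lebesgue_measure R) phi : {measure set mR -> \bar R}).
  exact: mphi.
by split => // f mf f0; rewrite ge0_integral_pushforward.
Qed.

(** Uniqueness of Lebesgue measure: the scaled push-forward gives half-open intervals their length.
    The signs of [a] are separated because a negative [a] moves the closed end to the other side. *)
Lemma lebesgue_measure_affine a b (A : set mR) : a != 0 -> measurable A ->
  (`|a|%:E * (@lebesgue_measure R) ((fun t : mR => b + a * t)%R @^-1` A))%E
  = lebesgue_measure A.
Proof.
move=> a0 mA; pose phi : mR -> mR := fun t => b + a * t.
have mphi : measurable_fun setT phi.
  by apply: measurable_funD => //; apply: measurable_funM.
have [P [PE _]] := pushforward_lebesgue mphi.
rewrite -PE -[LHS]/(mscale (NngNum (normr_ge0 a)) P A).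
apply/esym/lebesgue_measure_unique => // _ [[c d] _ <-].
rewrite [RHS]/= /mscale [X in (_ * X)%E]PE /=.
have [ap|an] := ltP 0 a.
  rewrite (_ : phi @^-1` _ = `](c - b) / a, (d - b) / a]%classic); last first.
    apply/seteqP; split => t /=; rewrite /phi !in_itv /=.
      by rewrite ltr_pdivrMr // ler_pdivlMr // mulrC; lra.
    by rewrite ltr_pdivrMr // ler_pdivlMr // [t * a]mulrC; lra.
  rewrite !lebesgue_measure_itv /= !lte_fin ltr_pM2r ?invr_gt0 // ltrD2r.
  case: ltP => cd; last by rewrite mule0.
  rewrite -!EFinB -EFinM gtr0_norm //; congr (_%:E); field.
  by rewrite gt_eqF.
have {}an : a < 0 by rewrite lt_neqAle a0.
rewrite (_ : phi @^-1` _ = `[(d - b) / a, (c - b) / a[%classic); last first.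
  apply/seteqP; split => t /=; rewrite /phi !in_itv /=.
    by rewrite ltr_ndivlMr // ler_ndivrMr // [t * a]mulrC; lra.
  by rewrite ltr_ndivlMr // ler_ndivrMr // [t * a]mulrC; lra.
rewrite !lebesgue_measure_itv /= !lte_fin ltr_nM2r ?invr_lt0 // ltrD2r.
case: ltP => cd; last by rewrite mule0.
rewrite -!EFinB -EFinM ltr0_norm //; congr (_%:E); field.
by rewrite lt_eqF.
Qed.

Lemma Rintegral_affine a b h M L : 0 <= L -> a != 0 -> (forall t, 0 <= h t) ->
  measurable_fun [set: mR] h ->
  (forall t, `|h t| <= M) -> (forall t, L < `|t| -> h t = 0) ->
  `|a| * Rintegral (@lebesgue_measure R) setT (fun t => h (b + a * t))
  = Rintegral (@lebesgue_measure R) setT h.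
Proof.
move=> L0 a0 h0 mh hM hL; pose phi : mR -> mR := fun t => b + a * t.
have mphi : measurable_fun setT phi.
  by apply: measurable_funD => //; apply: measurable_funM.
have ih := integrable_bsupp L0 mh hM hL.
have mEh : measurable_fun setT (EFin \o h) by exact/measurable_EFinP.
have key : (\int[lebesgue_measure]_t (h t)%:E =
    `|a|%:E * \int[lebesgue_measure]_t (h (phi t))%:E)%E.
  have [P [PE Pf]] := pushforward_lebesgue mphi.
  rewrite (@eq_measure_integral _ _ _ _ (mscale (NngNum (normr_ge0 a)) P)).
    rewrite ge0_integral_mscale //= => [|x _]; last by rewrite lee_fin.
    by rewrite Pf // => t; rewrite lee_fin.
  by move=> A mA _; rewrite [RHS]/= /mscale [X in (_ * X)%E]PE; exact/esym/lebesgue_measure_affine.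
rewrite /Rintegral key.
(* Finiteness is needed for [fine] to respect the product; it is inherited from the integral of [h],
   since an infinite factor times [|a|] > 0 would be infinite. *)
have fi : (\int[lebesgue_measure]_t (h (phi t))%:E)%E \is a fin_num.
  have := integrable_fin_num measurableT ih.
  rewrite /= key ge0_fin_numE; last by rewrite mule_ge0 ?integral_ge0 // => x _; rewrite lee_fin.
  rewrite ge0_fin_numE; last by rewrite integral_ge0 // => x _; rewrite lee_fin.
  move=> H; rewrite ltNge leye_eq; apply/negP => /eqP E; move: H.
  by rewrite E gt0_muley ?ltxx // lte_fin normr_gt0.
by rewrite fineM.
Qed.

End OneDim.

(** * Iterated integrals of bounded measurable functions with bounded support *)

Section IntegralOnRV.
Context {R : realType}.
Let mR : measurableType _ := measurableTypeR R.
Implicit Types (M L a c : R).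

(** Unlike integrability, this condition passes to every section with the same constants, which is
    what inductions on the dimension need. *)
Definition bms n (M L : R) (g : 'rV[R]_n -> R) :=
  [/\ measurable_fun setT (g : @borel_rV R n -> R), forall y, `|g y| <= M
    & forall y, L < `|y| -> g y = 0].

Lemma bmsD n M L M' L' (g h : 'rV[R]_n -> R) : bms M L g -> bms M' L' h ->
  bms (M + M') (Num.max L L') (fun y => g y + h y).
Proof.
case=> mg gM gL [mh hM hL]; split => [|y|y].
- exact: measurable_funD.
- by rewrite (le_trans (ler_normD _ _)) // lerD.
- by rewrite gt_max => /andP[/gL -> /hL ->]; rewrite addr0.
Qed.

Lemma bmsZ n M L c (g : 'rV[R]_n -> R) : bms M L g ->
  bms (`|c| * M) L (fun y => c * g y).
Proof.
case=> mg gM gL; split => [|y|y /gL ->]; last by rewrite mulr0.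
- exact: measurable_funM.
- by rewrite normrM ler_wpM2l.
Qed.

Lemma measurable_section n (g : 'rV[R]_n.+1 -> R) t :
  measurable_fun setT (g : @borel_rV R n.+1 -> R) ->
  measurable_fun setT ((fun y => g (consrV t y)) : @borel_rV R n -> R).
Proof.
move=> mg; have h : measurable_fun setT (fun y : @borel_rV R n => (t : mR, y)).
  exact: measurable_fun_pair.
exact: (measurableT_comp mg (measurableT_comp (@measurable_consrV R n) h)).
Qed.

Lemma bms_section n M L (g : 'rV[R]_n.+1 -> R) t : bms M L g ->
  bms M L (fun y => g (consrV t y)).
Proof.
case=> mg gM gL; split => [|y|y Ly]; [exact: measurable_section|exact: gM|].
by apply: gL; rewrite (lt_le_trans Ly) //; case: (consrV_norm t y).
Qed.

(** The bound 0 lets the norm estimate for [iint] conclude that the section integral vanishes, which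
    gives bounded support in the outer variable. *)
Lemma bms_section0 n M L (g : 'rV[R]_n.+1 -> R) t : bms M L g -> L < `|t| ->
  bms 0 L (fun y => g (consrV t y)).
Proof.
move=> bg Lt; have g0 y : g (consrV t y) = 0.
  case: bg => _ _; apply; rewrite (lt_le_trans Lt) //.
  by case: (consrV_norm t y).
by have [mg _ _] := bms_section t bg; split => // y; rewrite g0 ?normr0.
Qed.

Lemma measurable_iint_section n (g : 'rV[R]_n.+1 -> R) :
  measurable_fun setT (g : @borel_rV R n.+1 -> R) ->
  measurable_fun [set: mR] (fun t => iint (fun y => g (consrV t y))).
Proof.
move=> mg.
apply: (@measurable_iint R n _ mR (fun p => g (consrV p.1 p.2))).
exact: (measurableT_comp mg (@measurable_consrV R n)).
Qed.

Lemma iint_norm_le n M L (g : 'rV[R]_n -> R) : 0 <= L -> bms M L g ->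
  `|iint g| <= M * (2 * L) ^+ n.
Proof.
move=> L0; elim: n M g => [|n IH] M g bg.
  by case: bg => _ gM _; rewrite expr0 mulr1; exact: gM.
rewrite exprSr [M * _]mulrA.
apply: (@Rintegral_bsupp_le R (fun t => iint (fun y => g (consrV t y)))) => //.
- by case: bg => mg _ _; exact: measurable_iint_section.
- by move=> t; apply: IH; exact: bms_section.
- move=> t Lt; apply/eqP; rewrite -normr_le0.
  by rewrite (le_trans (IH _ _ (bms_section0 bg Lt))) // mul0r.
Qed.

Lemma bsupp_iint_section n M L (g : 'rV[R]_n.+1 -> R) : 0 <= L -> bms M L g ->
  [/\ measurable_fun [set: mR] (fun t => iint (fun y => g (consrV t y))),
      forall t, `|iint (fun y => g (consrV t y))| <= M * (2 * L) ^+ n &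
      forall t, L < `|t| -> iint (fun y => g (consrV t y)) = 0].
Proof.
move=> L0 bg; split.
- by case: bg => mg _ _; exact: measurable_iint_section.
- by move=> t; apply: iint_norm_le => //; exact: bms_section.
- move=> t Lt; apply/eqP; rewrite -normr_le0.
  by rewrite (le_trans (iint_norm_le L0 (bms_section0 bg Lt))) // mul0r.
Qed.

Lemma integrable_iint_section n M L (g : 'rV[R]_n.+1 -> R) : 0 <= L ->
  bms M L g -> (@lebesgue_measure R).-integrable [set: mR]
    (EFin \o (fun t => iint (fun y => g (consrV t y)))).
Proof.
move=> L0 bg; have [mg gM gL] := bsupp_iint_section L0 bg.
exact: integrable_bsupp mg gM gL.
Qed.

Lemma iintD n M L M' L' (g h : 'rV[R]_n -> R) : 0 <= L -> 0 <= L' ->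
  bms M L g -> bms M' L' h -> iint (fun y => g y + h y) = iint g + iint h.
Proof.
move=> L0 L'0; elim: n g h => // n IH g h bg bh /=.
rewrite -RintegralD //; [|exact: integrable_iint_section bg|
  exact: integrable_iint_section bh].
by apply: eq_Rintegral => t _; rewrite -IH; [|exact: bms_section..].
Qed.

Lemma iintZ n M L c (g : 'rV[R]_n -> R) : 0 <= L ->
  bms M L g -> iint (fun y => c * g y) = c * iint g.
Proof.
move=> L0; elim: n g => // n IH g bg /=.
rewrite -RintegralZl //; last exact: integrable_iint_section bg.
by apply: eq_Rintegral => t _; rewrite -IH //; exact: bms_section.
Qed.

Lemma iint_ge0 n (g : 'rV[R]_n -> R) : (forall y, 0 <= g y) -> 0 <= iint g.
Proof.
by elim: n g => [|n IH] g g0 //=; apply: Rintegral_ge0 => t _; exact: IH.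
Qed.

Lemma eq_iint n (g h : 'rV[R]_n -> R) : g =1 h -> iint g = iint h.
Proof. by move=> gh; congr iint; apply: funext. Qed.

Lemma consrV_split n (p : 'rV[R]_n.+1) : exists p0 p', p = consrV p0 p'.
Proof.
exists (p ord0 ord0), (\row_j p ord0 (lift ord0 j)).
by apply/rowP => j; rewrite consrVE; case: unliftP => [k|] -> //=; rewrite mxE.
Qed.

(** Balls of the sup norm are cubes, so the induction only has to restrict the outer variable to an
    interval of length 2 [rho]. This is the source of all strict inequalities between averages. *)
Lemma iint_gt_cube n M L (g : 'rV[R]_n -> R) (p : 'rV[R]_n) (rho c : R) :
  0 <= L -> bms M L g -> (forall y, 0 <= g y) -> 0 < rho -> 0 <= c ->
  (forall y, `|y - p| < rho -> c <= g y) -> c * (2 * rho) ^+ n <= iint g.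
Proof.
move=> L0 + + rho0; elim: n g p c => [|n IH] g p c bg g0 c0 gc /=.
  by rewrite mulr1; apply: gc; rewrite [0 - p]thinmx0 normr0.
have [p0 [p' pE]] := consrV_split p.
pose D := `]p0 - rho, p0 + rho[%classic.
have mD : measurable (D : set mR) by exact: measurable_itv.
have muE : (@lebesgue_measure R) D = (2 * rho)%:E.
  rewrite /D lebesgue_measure_itv /= lte_fin ltrD2l gtrN // -EFinB.
  by congr (_%:E); ring.
have muD : fine ((@lebesgue_measure R) D) = 2 * rho by rewrite muE.
have [mg gM gL] := bsupp_iint_section L0 bg.
pose h t := iint (fun y => g (consrV t y)).
have ih := integrable_bsupp L0 mg gM gL.
have ihD : (@lebesgue_measure R).-integrable (D : set mR) (EFin \o h).
  exact: integrableS ih.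
apply: (@le_trans _ _ (Rintegral (@lebesgue_measure R) (D : set mR) h)).
  rewrite exprSr [c * _]mulrA -[X in _ * X <= _]muD -Rintegral_cst //; apply: le_Rintegral => //.
    apply: measurable_bounded_integrable => //.
      by rewrite [X in (X < _)%E]muE ltry.
    exists `|c * (2 * rho) ^+ n|; split; first exact: num_real.
    by move=> y My x _ /=; rewrite ltW.
  move=> t Dt; apply: (IH _ p') => // [|y yp']; first exact: bms_section.
  apply: gc; rewrite pE; apply: consrV_lipschitz => //.
  by move: Dt; rewrite /D /= in_itv /= ltr_norml; lra.
rewrite Rintegral_mkcond; apply: le_Rintegral => //.
  by rewrite -restrict_EFin; apply/(integrable_mkcond _ mD).
move=> t _; rewrite patchE; case: ifPn => // _.
exact: iint_ge0.
Qed.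

Lemma consrV_affine n (b0 t a : R) (b' y : 'rV[R]_n) :
  consrV b0 b' + a *: consrV t y = consrV (b0 + a * t) (b' + a *: y).
Proof.
apply/rowP => j; rewrite [LHS]mxE [X in _ + X]mxE !consrVE.
by case: unliftP => [k|] _ //=; rewrite !mxE.
Qed.

Lemma measurable_continuous_rV n m (phi : 'rV[R]_n -> 'rV[R]_m) :
  continuous phi -> measurable_fun setT (phi : @borel_rV R n -> @borel_rV R m).
Proof.
move=> cphi; apply: (@measurability _ _ (@borel_rV R n) (@borel_rV R m) setT _
  (@open 'rV[R]_m)) => // _ [A oA <-]; rewrite setTI.
by apply: open_measurable_rV; move/continuousP : cphi; exact.
Qed.

Lemma bms_affine n M L (g : 'rV[R]_n -> R) (b : 'rV[R]_n) a : a != 0 -> bms M L g ->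
  bms M ((`|b| + L) / `|a|) (fun z => g (b + a *: z)).
Proof.
move=> a0 [mg gM gL]; split => [|y|y]; last 2 first.
- exact: gM.
- rewrite ltr_pdivrMr ?normr_gt0 // => Ly; apply: gL.
  rewrite -(ltrD2l `|b|) (lt_le_trans Ly) // mulrC -normrZ.
  rewrite -lerBlDl -[`|b| in leLHS]normrN.
  by rewrite (le_trans (lerB_dist _ _)) // opprK addrC.
apply: (measurableT_comp mg); apply: measurable_continuous_rV => y.
by apply: continuousD; [exact: cst_continuous|exact: scaler_continuous].
Qed.

(** One affine change of variable on the line per coordinate, each contributing a factor [|a|]. *)
Lemma iint_affine_ge0 n M L (g : 'rV[R]_n -> R) (b : 'rV[R]_n) a : 0 <= L -> a != 0 ->
  bms M L g -> (forall y, 0 <= g y) ->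
  `|a| ^+ n * iint (fun z => g (b + a *: z)) = iint g.
Proof.
move=> L0 a0; elim: n g b => [|n IH] g b bg g0.
  by rewrite mul1r /=; congr g; exact: thinmx0.
have [b0 [b' ->]] := consrV_split b.
have L'0 : 0 <= (`|consrV b0 b'| + L) / `|a| by rewrite divr_ge0 // addr_ge0.
rewrite exprS -mulrA /= -RintegralZl //; last first.
  exact: (integrable_iint_section L'0 (bms_affine (consrV b0 b') a0 bg)).
have [mg gM gL] := bsupp_iint_section L0 bg.
rewrite -(@Rintegral_affine _ a b0 _ _ _ L0 a0 _ mg gM gL); last first.
  by move=> t; exact: iint_ge0.
congr (_ * _); apply: eq_Rintegral => t _ /=.
rewrite -(IH (fun y => g (consrV (b0 + a * t) y)) b') //; last exact: bms_section.
by congr (_ * _); apply: eq_iint => y; rewrite consrV_affine.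
Qed.

Lemma iint_affine n M L (g : 'rV[R]_n -> R) (b : 'rV[R]_n) a : 0 <= L -> a != 0 ->
  bms M L g -> `|a| ^+ n * iint (fun z => g (b + a *: z)) = iint g.
Proof.
move=> L0 a0 bg.
have bn : bms M L (fun y => `|g y|).
  case: bg => mg gM gL; split => [|y|y /gL ->]; rewrite ?normr_id ?normr0 //.
  exact: measurableT_comp.
have bp := bmsD bg bn.
have bnN := bmsZ (-1) bn.
have L'0 : 0 <= Num.max L L by rewrite maxxx.
have L''0 : 0 <= (`|b| + L) / `|a| by rewrite divr_ge0 // addr_ge0.
have L3 : 0 <= (`|b| + Num.max L L) / `|a| by rewrite divr_ge0 // addr_ge0.
(* A difference of two nonnegative functions of the same class; the nonnegative case applies to
   each. *)
have gE y : g y = (g y + `|g y|) + -1 * `|g y| by rewrite mulN1r addrK.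
rewrite (eq_iint gE) (iintD L'0 L0 bp bnN) (iintZ _ L0 bn).
rewrite -(iint_affine_ge0 b L'0 a0 bp); last first.
  by move=> y; have := ler_norm (- g y); rewrite normrN; lra.
rewrite -(iint_affine_ge0 b L0 a0 bn) //.
rewrite mulrCA -mulrDr -(iintZ (-1) L''0 (bms_affine b a0 bn)); congr (_ * _).
rewrite -(iintD L3 L''0 (bms_affine b a0 bp) (bmsZ (-1) (bms_affine b a0 bn))).
by apply: eq_iint => y; exact: gE.
Qed.

End IntegralOnRV.

(** * Averages over the unit ball *)

Section EuclideanNorm.
Context {R : realType}.
Implicit Types (a : R).

Lemma enorm_ge0 d (x : 'rV[R]_d) : 0 <= enorm x.
Proof. exact: sqrtr_ge0. Qed.

Lemma enorm_sqr d (x : 'rV[R]_d) : enorm x ^+ 2 = \sum_(i < d) x ord0 i ^+ 2.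
Proof. by rewrite sqr_sqrtr // sumr_ge0 // => i _; exact: sqr_ge0. Qed.

Lemma enormZ d a (x : 'rV[R]_d) : enorm (a *: x) = `|a| * enorm x.
Proof.
rewrite /enorm -sqrtr_sqr -sqrtrM ?sqr_ge0 // mulr_sumr; congr Num.sqrt.
by apply: eq_bigr => i _; rewrite mxE exprMn.
Qed.

Lemma enorm0 d : enorm (0 : 'rV[R]_d) = 0.
Proof. by rewrite -(scale0r (0 : 'rV[R]_d)) enormZ normr0 mul0r. Qed.

Lemma enormN d (x : 'rV[R]_d) : enorm (- x) = enorm x.
Proof. by rewrite -scaleN1r enormZ normrN1 mul1r. Qed.

Lemma enormC d (x y : 'rV[R]_d) : enorm (x - y) = enorm (y - x).
Proof. by rewrite -opprB enormN. Qed.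

Lemma norm_le_enorm d (x : 'rV[R]_d) : `|x| <= enorm x.
Proof.
apply: mx_norm_leP => [|i j]; first exact: enorm_ge0.
rewrite (ord1 i) -sqrtr_sqr /enorm ler_wsqrtr // (bigD1 j) //= lerDl.
by rewrite sumr_ge0 // => k _; exact: sqr_ge0.
Qed.

(** The constant is not sharp; it only serves to compare the Euclidean norm with the sup norm. *)
Lemma enorm_le_norm d (x : 'rV[R]_d) : enorm x <= d%:R * `|x|.
Proof.
rewrite -(ger0_norm (mulr_ge0 (ler0n R d) (normr_ge0 x))) -sqrtr_sqr.
apply: ler_wsqrtr; rewrite exprMn.
apply: (@le_trans _ _ (\sum_(i < d) `|x| ^+ 2)).
  by apply: ler_sum => i _; rewrite -real_normK ?num_real // lerXn2r ?nnegrE //;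
    exact: le_coord_mx_norm.
rewrite sumr_const card_ord -[leLHS]mulr_natl ler_wpM2r ?sqr_ge0 //.
by rewrite -natrX ler_nat; case: (d) => // k; rewrite leq_pmulr.
Qed.

Lemma open_unit_eball d : open (eball (0 : 'rV[R]_d) 1).
Proof.
have cs : continuous (fun x : 'rV[R]_d => \sum_(i < d) x ord0 i ^+ 2).
  rewrite -[X in continuous X]fct_sumE.
  elim/big_ind : _ => [|f g cf cg x|i _ x].
  - exact: cst_continuous.
  - by apply: continuousD; [exact: cf|exact: cg].
  - apply: (@continuous_comp _ _ _ (fun x : 'rV[R]_d => x ord0 i) (fun t : R => t ^+ 2)).
      exact: coord_continuous.
    exact: exprn_continuous.
rewrite (_ : eball 0 1 = [set x | \sum_(i < d) x ord0 i ^+ 2 < 1]).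
  by apply: (@open_comp _ _ _ [set t : R | t < 1]) => [x _|]; [exact: cs|exact: open_lt].
apply/seteqP; split => x; rewrite /eball /= subr0 -enorm_sqr;
  by rewrite expr_lt1 // enorm_ge0.
Qed.

End EuclideanNorm.

Section UnitBallAverage.
Context {R : realType} {d : nat}.
Local Notation Z := (eball (0 : 'rV[R]_d) 1).
Implicit Types (g h : 'rV[R]_d -> R).

(** Bounded and continuous on the open unit ball, with no condition elsewhere. Boundedness is a
    separate clause because the open ball is not compact. *)
Definition bcont g :=
  (exists B, forall z, Z z -> `|g z| <= B) /\
  (forall z, Z z -> forall e : R, 0 < e -> exists2 del, 0 < del &
     forall z', Z z' -> `|z - z'| < del -> `|g z - g z'| < e).

Lemma bcont_cst c : bcont (fun=> c).
Proof.
split; first by exists `|c|.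
by move=> z _ e e0; exists 1 => // z' _ _; rewrite subrr normr0.
Qed.

Lemma eball0 : Z 0.
Proof. by rewrite /eball /= subr0 enorm0. Qed.

Lemma eballN z : Z z -> Z (- z).
Proof. by rewrite /eball /= !subr0 enormN. Qed.

Lemma measurable_eball : measurable (Z : set (@borel_rV R d)).
Proof. by apply: open_measurable_rV; exact: open_unit_eball. Qed.

Lemma indE g : (fun z => g z * ind Z z) = g \_ Z.
Proof.
apply: funext => z; rewrite /ind patchE.
by case: ifPn => _; rewrite ?mulr1 ?mulr0.
Qed.

Lemma bms_bcont g : bcont g -> exists2 B, 0 <= B & bms B 1 (fun z => g z * ind Z z).
Proof.
case=> -[B gB] gc; exists `|B| => //; rewrite indE; split => [|z|z z1].
- apply/(measurable_restrictT _ measurable_eball).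
  (* It suffices to treat open rays: the points of the ball where [g] exceeds a given [c] form an
     open set. *)
  apply: (measurability _ (RGenOInfty.measurableE R)).
  move=> _ [_ [c ->]] <-; apply: open_measurable_rV.
  rewrite openE => z [Zz]; rewrite preimage_itvoy /= => cg; rewrite /interior.
  have /nbhs_ballP[e /= e0 eZ] : nbhs z Z.
    by apply: open_nbhs_nbhs; split => //; exact: open_unit_eball.
  have [|del del0 gdel] := gc z Zz (g z - c); first by rewrite subr_gt0.
  apply/nbhs_ballP; exists (Num.min e del) => /=; first by rewrite lt_min e0.
  move=> z'; rewrite -ball_normE /= lt_min => /andP[ze zd].
  have Zz' : Z z' by apply: eZ; rewrite -ball_normE.
  split => //; have := gdel z' Zz' zd.
  by rewrite ltr_norml; lra.
- rewrite patchE; case: ifPn => [/set_mem Zz|_]; last by rewrite normr0.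
  by rewrite (le_trans (gB z Zz)) // ler_norm.
- rewrite patchE memNset //; rewrite /eball /= subr0 => Zz.
  by have := norm_le_enorm z; lra.
Qed.

Lemma ind1 z : Z z -> ind Z z = 1.
Proof. by move=> Zz; rewrite /ind mem_set. Qed.

Lemma ind0 z : ~ Z z -> ind Z z = 0.
Proof. by move=> Zz; rewrite /ind memNset. Qed.

Lemma unit_eball_cube p (rho : R) : Z p -> 0 < rho -> exists2 del, 0 < del &
  forall z, `|z - p| < del -> Z z /\ `|z - p| < rho.
Proof.
move=> Zp rho0; have /nbhs_ballP[e /= e0 eZ] : nbhs p Z.
  by apply: open_nbhs_nbhs; split => //; exact: open_unit_eball.
exists (Num.min e rho); first by rewrite lt_min e0.
move=> z; rewrite lt_min => /andP[ze zr]; split => //; apply: eZ.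
by rewrite -ball_normE /= distrC.
Qed.

Lemma leb_meas_gt0 : 0 < leb_meas Z.
Proof.
have [B B0 b1] := bms_bcont (bcont_cst 1).
have [del del0 delZ] := unit_eball_cube eball0 ltr01.
apply: (@lt_le_trans _ _ (1 * (2 * del) ^+ d)).
  by rewrite mul1r exprn_gt0 // mulr_gt0.
apply: (iint_gt_cube (p := 0)) ler01 b1 _ _ _ _ => //.
  by move=> y; rewrite mul1r /ind; case: ifP.
by move=> y /delZ[Zy _]; rewrite mul1r ind1.
Qed.

Definition avg g := leb_int Z g / leb_meas Z.

(** Here [kappa] is the share of the unit ball filled by a cube around [p] lying in the ball and
    within [rho] of [p]: on it [h + c - g] is at least [s], elsewhere in the ball it is
    nonnegative. *)
Lemma avg_gap p (rho : R) : Z p -> 0 < rho -> exists2 kappa : R, 0 < kappa &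
  forall g h (c s : R), bcont g -> bcont h -> 0 <= s ->
    (forall z, Z z -> g z <= h z + c) ->
    (forall z, Z z -> `|z - p| < rho -> g z <= h z + c - s) ->
    avg g <= avg h + c - s * kappa.
Proof.
move=> Zp rho0; have [del del0 delZ] := unit_eball_cube Zp rho0.
exists ((2 * del) ^+ d / leb_meas Z).
  by rewrite divr_gt0 ?leb_meas_gt0 // exprn_gt0 // mulr_gt0.
move=> g h c s bg bh s0 gh ghs.
have [B1 _ b1] := bms_bcont (bcont_cst 1).
have [Bg _ bmg] := bms_bcont bg.
have [Bh _ bmh] := bms_bcont bh.
have L01 : (0 : R) <= 1 by [].
have L02 : (0 : R) <= Num.max 1 1 by rewrite maxxx.
have L03 : (0 : R) <= Num.max (Num.max 1 1) 1 by rewrite !maxxx.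
have bhc := bmsD bmh (bmsZ c b1).
have bf := bmsD bhc (bmsZ (-1) bmg).
have key : s * (2 * del) ^+ d <= leb_int Z h + c * leb_meas Z - leb_int Z g.
  rewrite -mulN1r /leb_meas /leb_int -(iintZ _ L01 b1) -(iintZ _ L01 bmg).
  rewrite -(iintD L01 L01 bmh (bmsZ c b1)) -(iintD L02 L01 bhc (bmsZ (-1) bmg)).
  apply: (iint_gt_cube (p := p) L03 bf) => // [z|z /delZ[Zz zr]].
    have [Zz|Zz] := pselect (Z z); last by rewrite ind0 // !mulr0 !addr0.
    by rewrite ind1 // !mulr1; have := gh z Zz; lra.
  by rewrite ind1 // !mulr1; have := ghs z Zz zr; lra.
have m0 := leb_meas_gt0.
rewrite /avg -(ler_pM2r m0) mulrBl mulrDl !mulrA.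
by rewrite !divfK ?gt_eqF //; lra.
Qed.

(** The change of variable z -> -z shows that the integral equals its opposite. *)
Lemma avg_odd g : bcont g -> (forall z, Z z -> g (- z) = - g z) -> avg g = 0.
Proof.
move=> bg go; have [B B0 bmg] := bms_bcont bg.
suff : leb_int Z g = 0 by rewrite /avg => ->; rewrite mul0r.
have N10 : (-1 : R) != 0 by rewrite oppr_eq0 oner_eq0.
have := iint_affine 0 ler01 N10 bmg.
rewrite normrN1 expr1n mul1r.
rewrite (@eq_iint _ _ _ (fun z => -1 * (g z * ind Z z))) => [|z].
  by rewrite (iintZ _ ler01 bmg) -/(leb_int Z g); lra.
rewrite add0r scaleN1r; have [Zz|Zz] := pselect (Z z).
  by rewrite go // !ind1 //; [ring|exact: eballN].
rewrite !ind0 ?mulr0 // => /eballN; by rewrite opprK.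
Qed.

Lemma leb_int_eball x (rho : R) u : 0 < rho -> bcont (fun z => u (x + rho *: z)) ->
  leb_int (eball x rho) u = rho ^+ d * leb_int Z (fun z => u (x + rho *: z)).
Proof.
move=> r0 bu; have [B B0 bmu] := bms_bcont bu.
have ri0 : rho^-1 != 0 by rewrite invr_eq0 gt_eqF.
(* The substitution is made in the integrand on the unit ball, the one known to be [bms]; hence the
   inverse map y -> (y - x) / [rho]. *)
rewrite {2}/leb_int -(iint_affine (- (rho^-1 *: x)) ler01 ri0 bmu).
rewrite mulrA gtr0_norm ?invr_gt0 // -exprMn mulfV ?gt_eqF // expr1n mul1r.
apply: eq_iint => y /=; set w := _ + rho^-1 *: y.
have xw : x + rho *: w = y.
  by rewrite /w scalerDr scalerN !scalerA mulfV ?gt_eqF // !scale1r addNKr.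
rewrite xw; congr (_ * _); rewrite /ind; congr (if _ then _ else _).
have yx : enorm (y - x) = rho * enorm w.
  by rewrite -{1}xw addrC addKr enormZ gtr0_norm.
apply/idP/idP => /set_mem H; apply/mem_set; move: H; rewrite /eball /= subr0 yx.
  by rewrite gtr_pMr.
by rewrite gtr_pMr.
Qed.

Lemma Mop_avg (r : 'rV[R]_d -> R) u x : 0 < r x ->
  bcont (fun z => u (x + r x *: z)) ->
  Mop r u x = avg (fun z => u (x + r x *: z)).
Proof.
move=> r0 bu; rewrite /Mop /avg /leb_meas (leb_int_eball r0 bu).
rewrite (leb_int_eball (u := fun=> 1) r0 (bcont_cst 1)).
by rewrite -mulf_div divff ?mul1r // expf_neq0 // gt_eqF.
Qed.

Lemma eball_image x (rho : R) : 0 < rho ->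
  eball x rho = (fun z => x + rho *: z) @` Z.
Proof.
move=> r0; apply/seteqP; split => [y|_ [z + <-]]; rewrite /eball /=.
  move=> xy; exists (rho^-1 *: (y - x)); last first.
    by rewrite scalerA mulfV ?gt_eqF // scale1r addrC subrK.
  by rewrite subr0 enormZ gtr0_norm ?invr_gt0 // mulrC ltr_pdivrMr // mul1r.
by rewrite subr0 addrC addKr enormZ gtr0_norm // gtr_pMr.
Qed.

(** * The operator T_alpha at one point, read on the unit ball *)

Section TugOfWarMean.
Variable alpha : R.
Hypotheses (alpha0 : 0 <= alpha) (alpha1 : alpha < 1).

Definition towmean g :=
  alpha * ((sup (g @` Z) + inf (g @` Z)) / 2) + (1 - alpha) * avg g.

Lemma Top_towmean (r : 'rV[R]_d -> R) u x : 0 < r x ->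
  bcont (fun z => u (x + r x *: z)) ->
  Top alpha r u x = towmean (fun z => u (x + r x *: z)).
Proof.
move=> r0 bu; rewrite /Top /towmean Mop_avg // /Sop eball_image //.
by rewrite image_comp.
Qed.

Lemma Z_image g : g @` Z !=set0.
Proof. by exists (g 0), 0 => //; exact: eball0. Qed.

Lemma bcont_ubound g : bcont g -> has_ubound (g @` Z).
Proof.
case=> -[B gB] _; exists B => _ [z Zz <-].
by have := gB z Zz; rewrite ler_norml; lra.
Qed.

Lemma bcont_lbound g : bcont g -> has_lbound (g @` Z).
Proof.
case=> -[B gB] _; exists (- B) => _ [z Zz <-].
by have := gB z Zz; rewrite ler_norml; lra.
Qed.

(* kappa depends only on the ball of radius rho around p: it survives the limit
   in which the remaining error in c tends to 0. *)
Lemma towmean_gap p (rho : R) : Z p -> 0 < rho -> exists2 kappa : R, 0 < kappa &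
  forall g h (c s : R), bcont g -> bcont h -> 0 <= s ->
    (forall z, Z z -> g z <= h z + c) ->
    (forall z, Z z -> `|z - p| < rho -> g z <= h z + c - s) ->
    towmean g <= towmean h + c - s * kappa.
Proof.
move=> Zp r0; have [kappa k0 kP] := avg_gap Zp r0.
exists ((1 - alpha) * kappa); first by rewrite mulr_gt0 // subr_gt0.
move=> g h c s bg bh s0 gh ghs.
have A := kP g h c s bg bh s0 gh ghs.
have S : sup (g @` Z) <= sup (h @` Z) + c.
  apply: ge_sup; first exact: Z_image.
  move=> _ [z Zz <-]; apply: (le_trans (gh z Zz)); rewrite lerD2r.
  by apply: ub_le_sup; [exact: bcont_ubound|exists z].
have I : inf (g @` Z) <= inf (h @` Z) + c.
  rewrite -lerBlDr; apply: lb_le_inf; first exact: Z_image.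
  move=> _ [z Zz <-]; rewrite lerBlDr; apply: le_trans (gh z Zz).
  by apply: ge_inf; [exact: bcont_lbound|exists z].
rewrite /towmean.
have := ler_wpM2l alpha0 (lerD S I).
have a1 : 0 <= 1 - alpha by rewrite subr_ge0 ltW.
have := ler_wpM2l a1 A.
lra.
Qed.

Lemma towmean_le g h c : bcont g -> bcont h -> (forall z, Z z -> g z <= h z + c) ->
  towmean g <= towmean h + c.
Proof.
move=> bg bh gh; have [k k0 /(_ g h c 0 bg bh (lexx _) gh)] := towmean_gap eball0 ltr01.
rewrite mul0r subr0; apply => z Zz _; rewrite subr0; exact: gh.
Qed.

Lemma towmean_odd g : bcont g -> (forall z, Z z -> g (- z) = - g z) -> towmean g = 0.
Proof.
move=> bg go; rewrite /towmean avg_odd // mulr0 addr0 /inf.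
(* As [inf] of a set is minus the [sup] of its opposite, a symmetric image makes [sup] and [inf]
   cancel. *)
rewrite (_ : -%R @` (g @` Z) = g @` Z); first by rewrite subrr mul0r mulr0.
rewrite image_comp; apply/seteqP; split => _ [z Zz <-]; exists (- z) => //=;
  by [exact: eballN|rewrite go ?opprK].
Qed.

(** On a ball, an affine function is its value at the centre plus an odd function; this lemma is
    what makes affine functions fixed by H. *)
Lemma towmean_cst_odd g c : bcont g -> (forall z, Z z -> g (- z) = - g z) ->
  bcont (fun z => c + g z) -> towmean (fun z => c + g z) = c.
Proof.
move=> bg go bcg; have g0 := towmean_odd bg go; apply/eqP; rewrite eq_le.
apply/andP; split.
  by rewrite -[leRHS]add0r -g0; apply: towmean_le => // z _; rewrite addrC.
rewrite -subr_le0 -g0 lerBlDr.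
have -> : towmean g = towmean g + 0 by rewrite addr0.
rewrite addr0 g0.
have := @towmean_le g _ (- c) bg bcg; rewrite g0 => H.
have : 0 <= towmean (fun z => c + g z) - c by apply: H => z _; rewrite addrAC subrr add0r.
by lra.
Qed.

End TugOfWarMean.

End UnitBallAverage.

(** * Compactness and barriers *)

Section Compactness.
Context {R : realType}.

(** The finite subcover argument once and for all: local constants have a positive minimum over a
    subcover. Uniform continuity, bounds, supporting normals, barriers and the contact set all use
    it, each with its own [P]. *)
Lemma compact_uniform (X : topologicalType) (K : set X) (P : R -> X -> Prop) :
  compact K -> (forall c c' x, c' <= c -> P c x -> P c' x) ->
  (forall x, K x -> exists2 c, 0 < c & \forall x' \near x, K x' -> P c x') ->
  exists2 c, 0 < c & forall x, K x -> P c x.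
Proof.
move=> /compact_near_coveringP/near_covering_withinP cK Pmon Ploc.
have [e /= e0 eP] : \forall i \near (0 : R)^'+, K `<=` P i.
  apply: cK => x Kx; have [c c0 Px] := Ploc x Kx.
  near=> x' i.
  have ic : i <= c by near: i; exact: nbhs_right_le.
  have Pc : K x' -> P c x' by near: x'.
  by move=> /Pc; exact: Pmon.
exists (e / 2) => [|x Kx]; first by rewrite divr_gt0.
apply: eP => //=; last by rewrite divr_gt0.
by rewrite sub0r normrN gtr0_norm ?divr_gt0 // ltr_pdivrMr // ltr_pMr // ltr1n.
Unshelve. all: by end_near. Qed.

Lemma continuous_rV_ball d (f : 'rV[R]_d -> R) :
  (forall x e, 0 < e -> exists2 del, 0 < del &
    forall y, `|x - y| < del -> `|f x - f y| < e) -> continuous f.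
Proof.
move=> H x B /nbhs_ballP[e /= e0 eB]; have [del del0 delP] := H x e e0.
apply/nbhs_ballP; exists del => //= y; rewrite -ball_normE /= => xy.
by apply: eB; rewrite -ball_normE /=; exact: delP.
Qed.

Definition ucont d (K : set 'rV[R]_d) (f : 'rV[R]_d -> R) :=
  forall e, 0 < e -> exists2 del, 0 < del &
    forall x y, K x -> K y -> `|x - y| < del -> `|f x - f y| < e.

Lemma withinP_ball d (K : set 'rV[R]_d) (f : 'rV[R]_d -> R) :
  {within K, continuous f} <->
  forall x, K x -> forall e, 0 < e -> exists2 del, 0 < del &
    forall y, K y -> `|x - y| < del -> `|f x - f y| < e.
Proof.
rewrite subspace_continuousP; split => H x Kx.
  move=> e e0; have /cvgrPdist_lt/(_ e e0) := H x Kx.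
  rewrite near_withinE => /nbhs_ballP[del /= del0 delP]; exists del => // y Ky xy.
  by apply: delP => //; rewrite -ball_normE.
apply/cvgrPdist_lt => e e0; have [del del0 delP] := H x Kx e e0.
rewrite near_withinE; apply/nbhs_ballP; exists del => //= y.
by rewrite -ball_normE /= => xy Ky; exact: delP.
Qed.

Lemma ucont_within d (K : set 'rV[R]_d) (f : 'rV[R]_d -> R) :
  ucont K f -> {within K, continuous f}.
Proof.
move=> uf; apply/withinP_ball => x Kx e /uf[del del0 delP].
by exists del => // y Ky; exact: delP.
Qed.

Lemma within_ucont d (K : set 'rV[R]_d) (f : 'rV[R]_d -> R) : compact K ->
  {within K, continuous f} -> ucont K f.
Proof.
move=> cK /withinP_ball cf e e0.
pose P c x := forall y, K y -> `|x - y| < c -> `|f x - f y| < e.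
have [|x Kx|c c0 cP] := @compact_uniform _ K P cK.
- by move=> c c' x cc' Pc y Ky xy; apply: Pc => //; exact: lt_le_trans cc'.
- have e20 : 0 < e / 2 by rewrite divr_gt0.
  have [del del0 delP] := cf x Kx _ e20.
  exists (del / 2); first by rewrite divr_gt0.
  apply/nbhs_ballP; exists (del / 2); first by rewrite /= divr_gt0.
  move=> x'; rewrite -ball_normE /= => xx' Kx' y Ky x'y.
  have xy : `|x - y| < del.
    rewrite (splitr del) -(subrK x' x) -addrA.
    by rewrite (le_lt_trans (ler_normD _ _)) // ltrD.
  have h1 := delP y Ky xy.
  have h2 : `|f x - f x'| < e / 2.
    by apply: delP => //; apply: lt_trans xx' _; rewrite ltr_pdivrMr // ltr_pMr // ltr1n.
  by move: h1 h2; rewrite !ltr_norml; lra.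
- by exists c => // x y Kx; exact: cP.
Qed.

Lemma ucont_bounded d (K : set 'rV[R]_d) (f : 'rV[R]_d -> R) : compact K ->
  ucont K f -> exists2 B, 0 < B & forall x, K x -> `|f x| <= B.
Proof.
(* The bound is written as an inverse so that the condition weakens as [c] decreases. *)
move=> cK uf; pose P c x := `|f x| <= c^-1.
have [|x Kx|c c0 cP] := @compact_uniform _ K (fun c x => 0 < c -> P c x) cK.
- move=> c c' x cc' Pc c'0; have c0 := lt_le_trans c'0 cc'.
  by apply: (le_trans (Pc c0)); rewrite lef_pV2.
- have [del del0 delP] := uf 1 ltr01.
  have a0 : 0 < `|f x| + 1 by rewrite ltr_wpDl.
  exists (`|f x| + 1)^-1; first by rewrite invr_gt0.
  apply/nbhs_ballP; exists del => // x'; rewrite -ball_normE /= => xx' Kx' _.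
  rewrite /P invrK; have := delP x x' Kx Kx' xx'.
  by have := ler_norm (f x); have := ler_norm (- f x); rewrite normrN !ler_norml ltr_norml; lra.
- by exists c^-1; [rewrite invr_gt0|move=> x Kx; exact: cP].
Qed.

End Compactness.

(** * Separation, supporting normals and strict convexity *)

Section Barrier.
Context {R : realType} {d : nat}.
Implicit Types (x y u v w n : 'rV[R]_d) (a t : R).

Definition dot u v : R := \sum_(i < d) u ord0 i * v ord0 i.

Lemma dotDr u v w : dot u (v + w) = dot u v + dot u w.
Proof. by rewrite -big_split; apply: eq_bigr => i _; rewrite mxE mulrDr. Qed.

Lemma dotZr a u v : dot u (a *: v) = a * dot u v.
Proof. by rewrite mulr_sumr; apply: eq_bigr => i _; rewrite mxE mulrCA. Qed.

Lemma dotC u v : dot u v = dot v u.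
Proof. by apply: eq_bigr => i _; rewrite mulrC. Qed.

Lemma dotNr u v : dot u (- v) = - dot u v.
Proof. by rewrite -scaleN1r dotZr mulN1r. Qed.

Lemma dotBr u v w : dot u (v - w) = dot u v - dot u w.
Proof. by rewrite dotDr dotNr. Qed.

Lemma dot_le u v : `|dot u v| <= d%:R * (`|u| * `|v|).
Proof.
apply: (le_trans (ler_norm_sum _ _ _)).
apply: (@le_trans _ _ (\sum_(i < d) `|u| * `|v|)).
  by apply: ler_sum => i _; rewrite normrM ler_pM // le_coord_mx_norm.
by rewrite sumr_const card_ord mulr_natl.
Qed.

Lemma dot_gt0 u : u != 0 -> 0 < dot u u.
Proof.
move=> u0; rewrite lt_neqAle; apply/andP; split.
  apply: contra u0 => /eqP; rewrite /dot => /esym u0; apply/eqP/rowP => i.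
  have := @psumr_eq0P _ _ predT (fun i => u ord0 i * u ord0 i).
  move=> /(_ _ u0 i isT); rewrite mxE => H; apply/eqP.
  by rewrite -sqrf_eq0 expr2 H // => j _; rewrite -expr2 sqr_ge0.
by apply: sumr_ge0 => i _; rewrite -expr2 sqr_ge0.
Qed.

Lemma dot_continuous u : continuous (dot u).
Proof.
apply: continuous_rV_ball => x e e0.
have D0 : 0 < d%:R * `|u| + 1 by rewrite ltr_wpDl // mulr_ge0.
exists (e / (d%:R * `|u| + 1)); first by rewrite divr_gt0.
move=> y; rewrite ltr_pdivlMr // => xy.
rewrite -dotBr (le_lt_trans (dot_le _ _)) // (le_lt_trans _ xy) // mulrA mulrC.
by rewrite ler_wpM2l // lerDl.
Qed.

Lemma dot_continuousl v : continuous (dot ^~ v).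
Proof.
by rewrite (_ : dot ^~ v = dot v); [exact: dot_continuous|apply: funext => u; rewrite dotC].
Qed.

Variable O : set 'rV[R]_d.
Hypotheses (oO : open O) (O0 : O !=set0) (bO : ebounded O) (scO : strictly_convex O).

Lemma bdryP x : bdry O x <-> closure O x /\ ~ O x.
Proof. by rewrite /bdry (interior_id O).1. Qed.

Lemma closure_ballP x : closure O x <-> forall e : R, 0 < e -> exists2 y, O y & `|x - y| < e.
Proof.
split=> [cx e e0|H B /nbhs_ballP[e /= e0 eB]].
  have [y [Oy xy]] := cx (ball x e) (nbhsx_ballx x e e0).
  by exists y => //; move: xy; rewrite -ball_normE.
by have [y Oy xy] := H e e0; exists y; split => //; apply: eB; rewrite -ball_normE.
Qed.

Lemma closure_compact : compact (closure O).
Proof.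
apply: bounded_closed_compact; last exact: closed_closure.
have [M OM] := bO; exists (M + 1); split; first exact: num_real.
move=> B MB x /closure_ballP /(_ 1 ltr01)[y Oy xy] /=.
have h1 := norm_le_enorm y; have h2 := OM y Oy.
have h3 : `|x| <= `|x - y| + `|y| by rewrite -{1}(subrK y x) ler_normD.
lra.
Qed.

Lemma closure_convex x y t : closure O x -> closure O y -> 0 <= t <= 1 ->
  closure O ((1 - t) *: x + t *: y).
Proof.
move=> /closure_ballP cx /closure_ballP cy t01; apply/closure_ballP => e e0.
have [x' Ox' xx'] := cx e e0; have [y' Oy' yy'] := cy e e0.
exists ((1 - t) *: x' + t *: y'); first by apply: scO.1.
rewrite opprD addrACA -!scalerBr (le_lt_trans (ler_normD _ _)) // !normrZ.
have [t0 t1] := andP t01; have t1' : 0 <= 1 - t by lra.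
rewrite !ger0_norm //; have [t00|t00] := eqVneq t 0; first by rewrite t00; lra.
have : t * `|y - y'| < t * e by rewrite ltr_pM2l // lt_neqAle eq_sym t00.
have : (1 - t) * `|x - x'| <= (1 - t) * e by rewrite ler_wpM2l // ltW.
lra.
Qed.

Lemma segment_interior x y t : O x -> closure O y -> 0 <= t < 1 ->
  O ((1 - t) *: x + t *: y).
Proof.
move=> Ox /closure_ballP cy /andP[t0 t1].
have /nbhs_ballP[e /= e0 eO] : nbhs x O by exact: open_nbhs_nbhs.
have t1' : 0 < 1 - t by lra.
have [y' Oy' yy'] := cy ((1 - t) * e) (mulr_gt0 t1' e0).
(* Replacing [y] by the nearby point [y'] of [O] is compensated by a shift of [x], which stays in
   the [e]-ball available around [x]. *)
pose x' := x + (t / (1 - t)) *: (y - y').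
have Ox' : O x'.
  apply: eO; rewrite -ball_normE /= /x' opprD addrA subrr sub0r normrN normrZ.
  rewrite normrM normfV !ger0_norm ?(ltW t1') // mulrAC ltr_pdivrMr // mulrC.
  rewrite (le_lt_trans _ (y := `|y - y'|)) //; last by rewrite mulrC.
  by rewrite mulrC ler_piMl // ltW.
have -> : (1 - t) *: x + t *: y = (1 - t) *: x' + t *: y'.
  rewrite /x' scalerDr scalerA mulrCA divff ?gt_eqF // mulr1 scalerBr -addrA.
  by rewrite subrK.
by apply: scO.1 => //; rewrite t0 ltW.
Qed.

(** The segment from a point [x0] of [O] to [x] is prolonged slightly beyond [x]. If its end were in
    the closure, [x] would lie in [O] by [segment_interior]. *)
Lemma exterior_near x (e : R) : bdry O x -> 0 < e ->
  exists2 y, ~ closure O y & `|y - x| < e.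
Proof.
move=> /bdryP[cx nOx] e0; have [x0 Ox0] := O0.
have D0 : 0 < `|x - x0| + 1 by rewrite ltr_wpDl.
pose t := e / (`|x - x0| + 1); have t0 : 0 < t by rewrite divr_gt0.
exists (x + t *: (x - x0)); last first.
  rewrite addrC addKr normrZ gtr0_norm // /t mulrAC ltr_pdivrMr //.
  by rewrite ltr_pM2l // ltrDl.
move=> cy; apply: nOx; pose s := (1 + t)^-1.
have s1 : s * (1 + t) = 1 by rewrite mulVf // gt_eqF // ltr_wpDl.
have -> : x = (1 - s) *: x0 + s *: (x + t *: (x - x0)).
  apply/rowP => i; rewrite !mxE.
  have -> : t = s^-1 - 1 by rewrite /s invrK addrC addKr.
  by field; rewrite invr_eq0 gt_eqF // ltr_wpDl.
apply: segment_interior => //; apply/andP; split.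
  by rewrite /s invr_ge0 addr_ge0 // ltW.
by rewrite /s invf_lt1 ?ltrDl // ltr_wpDl.
Qed.

(** The normal points from [x] to its nearest point [p] in the closure, and is normalised in the sup
    norm. *)
Lemma separating_normal x : ~ closure O x ->
  exists2 n, `|n| = 1 & forall y, closure O y -> 0 <= dot n (y - x).
Proof.
move=> ncx; pose f y := dot (y - x) (y - x).
have cf : continuous f.
  rewrite (_ : f = fun y => dot y y - 2 * dot x y + dot x x); last first.
    by apply: funext => y; rewrite /f dotBr ![dot (y - x) _]dotC !dotBr [dot y x]dotC; lra.
  have c1 : continuous (fun y => dot y y).
    rewrite /dot -[X in continuous X]fct_sumE.
    elim/big_ind : _ => [|g h cg ch z|i _ z].
    - exact: cst_continuous.
    - by apply: continuousD; [exact: cg|exact: ch].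
    - apply: (@continuous_comp _ _ _ (fun y : 'rV[R]_d => y ord0 i) (fun a : R => a * a)).
        exact: coord_continuous.
      by apply: cvgM; exact: cvg_id.
  move=> y; refine (@continuousD R R^o _ (fun y => dot y y - 2 * dot x y)
    (cst (dot x x)) y _ _); last exact: cst_continuous.
  refine (@continuousB R R^o _ (fun y => dot y y) (fun y => 2 * dot x y) y (c1 y) _).
  by apply: continuousM; [exact: cst_continuous|exact: dot_continuous].
have [p /set_mem Kp pmin] : exists2 v, v \in closure O &
    forall y, y \in closure O -> f v <= f y.
  apply: EVT_min_rV; [|exact: closure_compact|exact: continuous_subspaceT].
  by have [x0 Ox0] := O0; exists x0; exact: subset_closure.
pose m := p - x.
have m0 : m != 0 by apply: contra_not_neq ncx => /subr0_eq <-.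
have key y : closure O y -> 0 <= dot m (y - p).
  move=> Ky; rewrite leNgt; apply/negP => neg.
  pose q := dot (y - p) (y - p); pose b := - dot m (y - p).
  have b0 : 0 < b by rewrite oppr_gt0.
  have q0 : 0 <= q by apply: sumr_ge0 => i _; rewrite -expr2 sqr_ge0.
  (* This step is at most 1 and satisfies [t * q < b], so moving from [p] towards [y] by [t] changes
     the squared distance by -2tb + t^2 q < 0, against the choice of [p]. *)
  pose t := b / (q + b + 1).
  have D0 : 0 < q + b + 1 by lra.
  have t0 : 0 < t by rewrite divr_gt0.
  have t1 : t <= 1 by rewrite /t ler_pdivrMr //; lra.
  have tq : t * q < b.
    by rewrite /t mulrAC ltr_pdivrMr // ltr_pM2l //; lra.
  have Kt : closure O ((1 - t) *: p + t *: y).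
    by apply: closure_convex => //; rewrite t1 ltW.
  have := pmin _ (mem_set Kt); rewrite /f.
  have -> : (1 - t) *: p + t *: y - x = m + t *: (y - p).
    by apply/rowP => i; rewrite !mxE; ring.
  have E : dot (m + t *: (y - p)) (m + t *: (y - p)) = dot m m - 2 * (t * b) + t * (t * q).
    rewrite /b /q; generalize m (y - p) => v w.
    rewrite dotDr dotZr ![dot (v + _) _]dotC !dotDr !dotZr [dot w v]dotC.
    by ring.
  rewrite -/m E.
  have : t * (t * q) < t * b by rewrite ltr_pM2l.
  have := mulr_gt0 t0 b0; lra.
exists (`|m|^-1 *: m).
  by rewrite normrZ normfV normr_id mulVf // normr_eq0.
move=> y Ky; rewrite dotC dotZr dotC mulr_ge0 // ?invr_ge0 //.
have -> : y - x = (y - p) + m by rewrite /m addrA subrK.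
by rewrite dotDr addr_ge0 ?key // ltW // dot_gt0.
Qed.

(* Otherwise, by compactness of the unit sphere, every unit vector n has
   dot n (y - x) < - c for some y in the closure, with c independent of n; this
   contradicts the existence of separating normals at exterior points near x. *)
Lemma supporting_normal x : bdry O x ->
  exists2 n, `|n| = 1 & forall y, closure O y -> 0 <= dot n (y - x).
Proof.
move=> bx; apply: contrapT => H.
pose S := [set n : 'rV[R]_d | `|n| = 1].
have cS : compact S.
  apply: bounded_closed_compact.
    by exists 1; split; [exact: num_real|move=> B B1 n /= ->; exact: ltW].
  apply: (@closed_comp _ _ (fun n : 'rV[R]_d => `|n|) [set a | a = 1]).
    by move=> n _; exact: norm_continuous.
  exact: closed_eq.
pose P c n := exists2 y, closure O y & dot n (y - x) < - c.
have [|n Sn|c c0 cP] := @compact_uniform _ _ S P cS.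
- by move=> c c' n cc' [y Ky yc]; exists y => //; rewrite (lt_le_trans yc) // lerN2.
- have [y [Ky yn]] : exists y, closure O y /\ dot n (y - x) < 0.
    apply: contrapT => Hn; apply: H; exists n => // y Ky; rewrite leNgt.
    by apply/negP => yn; apply: Hn; exists y.
  pose c := - dot n (y - x) / 2.
  have c0 : 0 < c by rewrite divr_gt0 // oppr_gt0.
  exists c => //.
  have := @dot_continuousl (y - x) n; move=> /cvgrPdist_lt/(_ c c0).
  apply: filterS => n' nn' _; exists y => //; move: nn'.
  by rewrite ltr_norml /c; lra.
have D0 : 0 < d%:R + 1 :> R by rewrite ltr_wpDl.
have [y ny yx] := exterior_near bx (divr_gt0 c0 D0).
have [n n1 nP] := separating_normal ny.
have [z Kz] := cP n n1.
have -> : z - x = (z - y) + (y - x) by rewrite addrA subrK.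
rewrite dotDr; have := nP z Kz.
have : `|dot n (y - x)| < c.
  rewrite (le_lt_trans (dot_le _ _)) // n1 mul1r.
  move: yx; rewrite ltr_pdivlMr // => /(le_lt_trans _); apply.
  by rewrite mulrC ler_wpM2l // lerDl.
by rewrite ltr_norml; lra.
Qed.

(** A supporting functional is positive on [O], because one can still move a little in the direction
    [- n]. If it vanished at another boundary point, it would vanish at the midpoint, which strict
    convexity puts in [O]. *)
Lemma strict_barrier x : bdry O x -> exists n : 'rV[R]_d,
  forall y, closure O y -> y != x -> 0 < dot n (y - x).
Proof.
move=> bx; have [n n1 nP] := supporting_normal bx; exists n.
have n0 : n != 0 by rewrite -normr_eq0 n1 oner_eq0.
have pos y : O y -> 0 < dot n (y - x).
  move=> Oy; have /nbhs_ballP[e /= e0 eO] : nbhs y O by exact: open_nbhs_nbhs.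
  have e20 : 0 < e / 2 by rewrite divr_gt0.
  have Oy' : O (y - (e / 2) *: n).
    apply: eO; rewrite -ball_normE /= opprB addrC subrK normrZ n1 mulr1.
    by rewrite gtr0_norm // ltr_pdivrMr // ltr_pMr // ltr1n.
  have := nP _ (subset_closure Oy').
  have -> : y - (e / 2) *: n - x = (y - x) - (e / 2) *: n by rewrite addrAC.
  rewrite (dotBr n (y - x)) dotZr; have := mulr_gt0 e20 (dot_gt0 n0); lra.
move=> y Ky yx; rewrite lt_neqAle nP // andbT; apply/negP => /eqP yn.
have by' : bdry O y by apply/bdryP; split => // /pos; rewrite -yn ltxx.
have half : 0 < (2^-1 : R) < 1 by apply/andP; lra.
have := pos _ (scO.2 _ _ by' bx yx _ half).
have -> : (1 - 2^-1) *: y + 2^-1 *: x - x = 2^-1 *: (y - x).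
  by apply/rowP => i; rewrite !mxE; lra.
by rewrite dotZr -yn mulr0 ltxx.
Qed.

(** If the end of the segment were outside [O], the supremum of the parameters whose points lie in
    [O] would give a boundary point at distance less than [rho] from [x]. *)
Lemma eball_sub_domain x z (rho : R) : O x -> eball 0 1 z -> 0 < rho ->
  rho <= dist_to (bdry O) x -> O (x + rho *: z).
Proof.
move=> Ox Zz rho0 rd; apply: contrapT => nO.
pose pt (s : R) := x + (s * rho) *: z.
have ptB s s' : `|pt s - pt s'| = `|s - s'| * `|rho *: z|.
  by rewrite /pt opprD addrACA subrr add0r -scalerBl -mulrBl -scalerA normrZ.
pose A := [set s : R | 0 <= s <= 1 /\ O (pt s)].
have A0 : A 0 by split; [rewrite lexx ler01|rewrite /pt mul0r scale0r addr0].
have hsA : has_sup A by split; [exists 0|exists 1 => s [/andP[]]].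
have sA0 : 0 <= sup A by apply: ub_le_sup => //; case: hsA.
have sA1 : sup A <= 1 by apply: ge_sup; [exists 0|move=> s [/andP[]]].
have W0 : 0 < `|rho *: z| + 1 by rewrite ltr_wpDl.
have bp : bdry O (pt (sup A)).
  apply/bdryP; split.
    apply/closure_ballP => e e0.
    have [s As sAs] := sup_adherent (divr_gt0 e0 W0) hsA.
    have ss : s <= sup A by apply: ub_le_sup => //; case: hsA.
    exists (pt s); first by case: As.
    rewrite ptB ger0_norm ?subr_ge0 //.
    have : (sup A - s) * (`|rho *: z| + 1) < e.
      by rewrite -ltr_pdivlMr // ltrBlDr -ltrBlDl.
    apply: le_lt_trans; rewrite ler_wpM2l ?lerDl ?subr_ge0 //.
  move=> Op; have /nbhs_ballP[e /= e0 eO] : nbhs (pt (sup A)) O by exact: open_nbhs_nbhs.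
  pose del := e / (`|rho *: z| + 1).
  have del0 : 0 < del by rewrite divr_gt0.
  pose s := Num.min 1 (sup A + del / 2).
  have As : A s.
    split.
      by rewrite /s le_min ge_min ler01 lexx /= andbT addr_ge0 // divr_ge0 // ltW.
    apply: eO; rewrite -ball_normE /= ptB distrC.
    have : `|s - sup A| < del.
      have s1 : s <= sup A + del / 2 by rewrite /s ge_min lexx orbT.
      have s2 : sup A <= s by rewrite /s le_min sA1 lerDl divr_ge0 // ltW.
      by rewrite ger0_norm ?subr_ge0 //; lra.
    rewrite /del ltr_pdivlMr // => /(le_lt_trans _); apply.
    by rewrite ler_wpM2l // lerDl.
  have : s <= sup A by apply: ub_le_sup => //; case: hsA.
  rewrite /s ge_min => /orP[h|]; last by lra.
  apply: nO; have E : sup A = 1 by apply/eqP; rewrite eq_le sA1.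
  by move: Op; rewrite E /pt mul1r.
have : dist_to (bdry O) x <= enorm (x - pt (sup A)).
  apply: ge_inf; last by exists (pt (sup A)).
  by exists 0 => _ [y _ <-]; exact: enorm_ge0.
rewrite enormC /pt addrC addKr enormZ ger0_norm ?(mulr_ge0 sA0 (ltW rho0)) //.
move: Zz; rewrite /eball /= subr0 => Zz dle.
have : sup A * rho * enorm z <= rho * enorm z.
  by rewrite ler_wpM2r ?enorm_ge0 // ler_piMl // ltW.
have : rho * enorm z < rho by rewrite gtr_pMr.
lra.
Qed.

Lemma dist_to_le x y : bdry O y -> dist_to (bdry O) x <= enorm (x - y).
Proof.
move=> by'; apply: ge_inf; last by exists y.
by exists 0 => _ [z _ <-]; exact: enorm_ge0.
Qed.

End Barrier.

(** * The operator H on the closed domain *)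

Section Operator.
Context {R : realType} {d : nat}.
Variables (O : set 'rV[R]_d) (alpha : R) (r : 'rV[R]_d -> R).
Hypotheses (d_gt0 : (0 < d)%N) (oO : open O) (O0 : O !=set0) (bO : ebounded O)
  (scO : strictly_convex O) (alpha0 : 0 <= alpha) (alpha1 : alpha < 1)
  (r_adm : forall x, O x -> 0 < r x /\ r x <= dist_to (bdry O) x)
  (r_lip : forall x y, O x -> O y -> `|r x - r y| <= enorm (x - y)).
Local Notation Z := (eball (0 : 'rV[R]_d) 1).
Local Notation K := (closure O).
Local Notation H := (Hop O alpha r).
Implicit Types (u v w : 'rV[R]_d -> R) (x y z : 'rV[R]_d).

(* With radius 0 on the boundary, H u x is the mean of u x and of the value of
   towmean on the whole closed domain (see HopE). *)
Definition rad x : R := if x \in O then r x else 0.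

Definition probe x z : 'rV[R]_d := x + rad x *: z.

Lemma rad_in x : O x -> rad x = r x.
Proof. by move=> Ox; rewrite /rad mem_set. Qed.

Lemma rad_out x : ~ O x -> rad x = 0.
Proof. by move=> Ox; rewrite /rad memNset. Qed.

Lemma rad_ge0 x : 0 <= rad x.
Proof.
have [Ox|nOx] := pselect (O x); last by rewrite rad_out.
by rewrite rad_in //; exact/ltW/(r_adm Ox).1.
Qed.

(** The extension by 0 stays 1-Lipschitz across the boundary because [r] is at most the distance to
    the boundary. *)
Lemma rad_lip x y : K x -> K y -> `|rad x - rad y| <= enorm (x - y).
Proof.
have bd p q : O p -> K q -> ~ O q -> r p <= enorm (p - q).
  move=> Op Kq nOq; apply: le_trans (r_adm Op).2 _.
  by apply: dist_to_le; apply/(bdryP oO).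
move=> Kx Ky; have [Ox|nOx] := pselect (O x); have [Oy|nOy] := pselect (O y).
- by rewrite !rad_in //; exact: r_lip.
- by rewrite (rad_out nOy) subr0 ger0_norm ?rad_ge0 // rad_in //; exact: bd.
- rewrite (rad_out nOx) sub0r normrN ger0_norm ?rad_ge0 // rad_in // enormC.
  exact: bd.
- by rewrite !rad_out // subrr normr0 enorm_ge0.
Qed.

Lemma probe_closure x z : K x -> Z z -> K (probe x z).
Proof.
move=> Kx Zz; have [Ox|nOx] := pselect (O x); last first.
  by rewrite /probe rad_out // scale0r addr0.
apply: subset_closure; rewrite /probe rad_in //.
have [r0 rd] := r_adm Ox.
exact: (eball_sub_domain oO).
Qed.

Lemma probe_lip x y z : K x -> K y -> Z z ->
  `|probe x z - probe y z| <= (1 + d%:R) * `|x - y|.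
Proof.
move=> Kx Ky; rewrite /eball /= subr0 => Zz.
rewrite /probe opprD addrACA -scalerBl (le_trans (ler_normD _ _)) //.
rewrite mulrDl mul1r lerD2l normrZ.
rewrite (le_trans _ (enorm_le_norm (x - y))) // (le_trans _ (rad_lip Kx Ky)) //.
by rewrite ler_piMr // (le_trans (norm_le_enorm z)) // ltW.
Qed.

Lemma probe_dist x z z' : `|probe x z - probe x z'| = rad x * `|z - z'|.
Proof.
by rewrite /probe opprD addrACA subrr add0r -scalerBr normrZ ger0_norm ?rad_ge0.
Qed.

Let cK : compact K := closure_compact bO.

Lemma bcont_probe u x : ucont K u -> K x -> bcont (fun z => u (probe x z)).
Proof.
move=> uu Kx; have [B B0 uB] := ucont_bounded cK uu.
split; first by exists B => z Zz; apply: uB; exact: probe_closure.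
move=> z Zz e /uu[del del0 delP].
have D0 : 0 < rad x + 1 by rewrite ltr_wpDl // rad_ge0.
exists (del / (rad x + 1)); first by rewrite divr_gt0.
move=> z' Zz'; rewrite ltr_pdivlMr // => zz'.
apply: delP; [exact: probe_closure|exact: probe_closure|].
rewrite probe_dist (le_lt_trans _ zz') // mulrC ler_wpM2l //.
by rewrite lerDl.
Qed.

Lemma HopE u x : ucont K u -> K x ->
  H u x = (u x + towmean alpha (fun z => u (probe x z))) / 2.
Proof.
move=> uu Kx; rewrite /Hop; have [Ox|nOx] := pselect (O x).
  rewrite mem_set // Top_towmean; last 2 first.
  - by case: (r_adm Ox).
  - by have := bcont_probe uu Kx; rewrite /probe rad_in.
  by rewrite /probe rad_in.
(* Off [O] the radius is 0: the probed function is the constant [u x], seen as a constant plus the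
   odd function 0. *)
rewrite memNset // (_ : (fun z => _) = fun=> u x + 0); last first.
  by apply: funext => z; rewrite /probe rad_out // scale0r !addr0.
rewrite (@towmean_cst_odd _ _ _ alpha0 alpha1 (fun=> 0)).
- by field.
- exact: bcont_cst.
- by move=> z _; rewrite oppr0.
- exact: bcont_cst.
Qed.

(** By [probe_lip], one application of H shrinks the admissible [del] by the factor 1 + d. Each
    iterate is thus uniformly continuous, but no bound uniform in the rank results. *)
Lemma Hop_ucont u : ucont K u -> ucont K (H u).
Proof.
move=> uu e e0; have e20 : 0 < e / 2 by rewrite divr_gt0.
have [del del0 delP] := uu _ e20.
have D0 : 0 < 1 + d%:R :> R by rewrite ltr_pwDl.
exists (del / (1 + d%:R)); first by rewrite divr_gt0.
have half x y : K x -> K y -> `|x - y| < del / (1 + d%:R) -> H u x - H u y <= e / 2.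
  move=> Kx Ky; rewrite ltr_pdivlMr // mulrC => xy; rewrite !HopE //.
  have : towmean alpha (fun z => u (probe x z)) <=
         towmean alpha (fun z => u (probe y z)) + e / 2.
    apply: towmean_le => //; [exact: bcont_probe|exact: bcont_probe|].
    move=> z Zz; have := delP _ _ (probe_closure Kx Zz) (probe_closure Ky Zz).
    move=> /(_ (le_lt_trans (probe_lip Kx Ky Zz) xy)).
    by rewrite ltr_norml; lra.
  have : `|u x - u y| < e / 2.
    apply: delP => //; apply: le_lt_trans xy.
    by rewrite ler_peMl // lerDl.
  by rewrite ltr_norml; lra.
move=> x y Kx Ky xy; have h1 := half x y Kx Ky xy.
have h2 := half y x Ky Kx; rewrite distrC in h2; have {}h2 := h2 xy.
by rewrite ltr_norml; lra.
Qed.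

Lemma Hiter_ucont k u : ucont K u -> ucont K (Hiter O alpha r k u).
Proof. by move=> uu; elim: k => [//|k]; exact: Hop_ucont. Qed.

(** Comparison and non-expansiveness in one statement; only values on the closure matter. *)
Lemma Hop_le u v c : ucont K u -> ucont K v -> (forall x, K x -> u x <= v x + c) ->
  forall x, K x -> H u x <= H v x + c.
Proof.
move=> uu uv uvc x Kx; rewrite !HopE //.
have := uvc x Kx.
have : towmean alpha (fun z => u (probe x z)) <=
       towmean alpha (fun z => v (probe x z)) + c.
  apply: towmean_le => //; [exact: bcont_probe|exact: bcont_probe|].
  by move=> z Zz; apply: uvc; exact: probe_closure.
lra.
Qed.

Lemma ucont_affine a n x : ucont K (fun y => a + dot n (y - x)).
Proof.
move=> e e0; have D0 : 0 < d%:R * `|n| + 1 by rewrite ltr_wpDl // mulr_ge0.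
exists (e / (d%:R * `|n| + 1)); first by rewrite divr_gt0.
move=> y y' _ _; rewrite ltr_pdivlMr // => yy'.
rewrite [a + _]addrC addrKA -dotBr opprB addrA subrK.
rewrite (le_lt_trans (dot_le _ _)) // (le_lt_trans _ yy') // mulrA mulrC.
by rewrite ler_wpM2l // lerDl.
Qed.

Lemma Hop_affine a n x y : K y ->
  H (fun y => a + dot n (y - x)) y = a + dot n (y - x).
Proof.
move=> Ky; rewrite HopE //; last exact: ucont_affine.
suff -> : towmean alpha (fun z => a + dot n (probe y z - x)) = a + dot n (y - x).
  by field.
pose g z := dot n (probe y z - y).
have bg : bcont g.
  have := bcont_probe (ucont_affine 0 n y) Ky.
  by rewrite (_ : (fun z => _) = g) //; apply: funext => z; rewrite add0r.
have gE z : a + dot n (probe y z - x) = (a + dot n (y - x)) + g z.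
  rewrite -[RHS]addrA; congr (_ + _); rewrite /g -(dotDr n (y - x)).
  by congr (dot n _); rewrite [RHS]addrC addrA subrK.
have -> : (fun z => a + dot n (probe y z - x)) = fun z => (a + dot n (y - x)) + g z.
  exact: funext.
apply: towmean_cst_odd => //.
  move=> z _; rewrite /g /probe addrAC subrr add0r [y + _ - y]addrAC subrr add0r.
  by rewrite scalerN dotNr.
have := bcont_probe (ucont_affine a n x) Ky.
by rewrite (_ : (fun z => _) = fun z => (a + dot n (y - x)) + g z) //; exact: funext.
Qed.

Lemma Hiter_le_affine u a n x k : ucont K u ->
  (forall y, K y -> u y <= a + dot n (y - x)) ->
  forall y, K y -> Hiter O alpha r k u y <= a + dot n (y - x).
Proof.
move=> uu ul; elim: k => [//|k IH] y Ky.
rewrite -(Hop_affine a n x Ky) -[leRHS]addr0; apply: Hop_le => //.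
- exact: Hiter_ucont.
- exact: ucont_affine.
- by move=> x' Kx'; rewrite addr0; exact: IH.
Qed.

Lemma Hiter_ge_affine u a n x k : ucont K u ->
  (forall y, K y -> a + dot n (y - x) <= u y) ->
  forall y, K y -> a + dot n (y - x) <= Hiter O alpha r k u y.
Proof.
move=> uu ul; elim: k => [//|k IH] y Ky.
rewrite -(Hop_affine a n x Ky) -[leRHS]addr0; apply: Hop_le => //.
- exact: ucont_affine.
- exact: Hiter_ucont.
- by move=> x' Kx'; rewrite addr0; exact: IH.
Qed.

Lemma Hiter_bounded u : ucont K u -> exists2 B, 0 < B &
  forall k x, K x -> `|Hiter O alpha r k u x| <= B.
Proof.
move=> uu; have [B B0 uB] := ucont_bounded cK uu; exists B => // k x Kx.
have dot0 y : dot (0 : 'rV[R]_d) y = 0.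
  by rewrite dotC -(scale0r y) dotZr mul0r.
rewrite ler_norml; apply/andP; split.
  rewrite -[leLHS]addr0 -(dot0 (x - 0)); apply: Hiter_ge_affine => // y Ky.
  by rewrite dot0 addr0; have := uB y Ky; rewrite ler_norml => /andP[].
rewrite -[leRHS]addr0 -(dot0 (x - 0)); apply: Hiter_le_affine => // y Ky.
by rewrite dot0 addr0; have := uB y Ky; rewrite ler_norml => /andP[].
Qed.

(** Compactness turns the pointwise positivity of the strict barrier into one lower bound away from
    [x]. *)
Lemma barrier_away x (del : R) : bdry O x -> 0 < del -> exists n, exists2 c, 0 < c &
  forall y, K y -> 0 <= dot n (y - x) /\ (del <= `|y - x| -> c <= dot n (y - x)).
Proof.
move=> bx del0; have [n nP] := strict_barrier oO O0 bO scO bx.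
have n0 y : K y -> 0 <= dot n (y - x).
  move=> Ky; have [->|yx] := eqVneq y x; last exact/ltW/nP.
  by rewrite subrr -(scale0r x) dotZr mul0r.
have cdot : continuous (fun y => dot n (y - x)).
  apply: continuous_rV_ball => y e e0.
  have D0 : 0 < d%:R * `|n| + 1 by rewrite ltr_wpDl // mulr_ge0.
  exists (e / (d%:R * `|n| + 1)); first by rewrite divr_gt0.
  move=> y'; rewrite ltr_pdivlMr // => yy'.
  rewrite -dotBr opprB addrA subrK.
  rewrite (le_lt_trans (dot_le _ _)) // (le_lt_trans _ yy') // mulrA mulrC.
  by rewrite ler_wpM2l // lerDl.
exists n.
have [|y Ky|c c0 cP] := @compact_uniform _ _ K
  (fun c y => del <= `|y - x| -> c <= dot n (y - x)) cK.
- by move=> c c' y cc' Pc /Pc; exact: le_trans.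
- have [->|yx] := eqVneq y x.
    exists 1 => //; apply/nbhs_ballP; exists del => // y'.
    by rewrite -ball_normE /= distrC => /lt_geF ->.
  have py := nP y Ky yx; have p2 : 0 < dot n (y - x) / 2 by rewrite divr_gt0.
  exists (dot n (y - x) / 2) => //.
  have := cdot y; move=> /cvgrPdist_lt/(_ _ p2).
  by apply: filterS => y' + _ _; rewrite ltr_norml; lra.
- by exists c => // y Ky; split; [exact: n0|exact: cP].
Qed.

(** Equicontinuity at the boundary: [u] is squeezed between two affine functions close to [u x] near
    [x], and H preserves both inequalities. *)
Lemma Hiter_boundary u x e : ucont K u -> bdry O x -> 0 < e -> exists2 del, 0 < del &
  forall k y, K y -> `|x - y| < del -> `|Hiter O alpha r k u y - u x| <= e.
Proof.
move=> uu bx e0; have [Kx nOx] := (bdryP oO x).1 bx.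
have e20 : 0 < e / 2 by rewrite divr_gt0.
have [del del0 delP] := uu _ e20.
have [n [c c0 nP]] := barrier_away bx del0.
have [B B0 uB] := ucont_bounded cK uu.
(* This slope makes the barrier at least 2 [B], the largest possible oscillation of [u], at distance
   [del] or more from [x]. *)
pose C := 2 * B / c; have C0 : 0 <= C by rewrite divr_ge0 ?mulr_ge0 // ltW.
have bound y : K y -> `|u y - u x| <= e / 2 + C * dot n (y - x).
  move=> Ky; have [n0 nc] := nP y Ky.
  have [yx|yx] := ltP `|y - x| del.
    by have := delP y x Ky Kx yx; have := mulr_ge0 C0 n0; lra.
  have h : C * c <= C * dot n (y - x) by rewrite ler_wpM2l // nc.
  have CE : C * c = 2 * B by rewrite /C divfK // gt_eqF.
  have := ler_normB (u y) (u x); have := uB y Ky; have := uB x Kx; lra.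
have D0 : 0 < d%:R * `|C *: n| + 1 by rewrite ltr_wpDl // mulr_ge0.
exists (e / 2 / (d%:R * `|C *: n| + 1)); first by rewrite divr_gt0.
move=> k y Ky; rewrite ltr_pdivlMr // => xy.
have small : `|dot (C *: n) (y - x)| < e / 2.
  rewrite (le_lt_trans (dot_le _ _)) // (le_lt_trans _ xy) // mulrA mulrC distrC.
  by rewrite ler_wpM2l // lerDl.
have dC z : dot (C *: n) z = C * dot n z by rewrite dotC dotZr dotC.
have dNC z : dot (- (C *: n)) z = - (C * dot n z) by rewrite dotC dotNr dotC dC.
have up : Hiter O alpha r k u y <= u x + e / 2 + dot (C *: n) (y - x).
  apply: Hiter_le_affine => // y' Ky'; rewrite dC.
  by have := bound y' Ky'; rewrite ler_norml; lra.
have lo : u x - e / 2 + dot (- (C *: n)) (y - x) <= Hiter O alpha r k u y.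
  apply: Hiter_ge_affine => // y' Ky'; rewrite dNC.
  by have := bound y' Ky'; rewrite ler_norml; lra.
move: small up lo; rewrite dNC dC ltr_norml ler_norml; lra.
Qed.

(** * Half-relaxed limits and the merging of two orbits *)

Section Merging.
Variables u0 v0 : 'rV[R]_d -> R.
Hypotheses (uu0 : ucont K u0) (uv0 : ucont K v0)
  (uv_bdry : forall x, bdry O x -> u0 x = v0 x).
Let U k := Hiter O alpha r k u0.
Let V k := Hiter O alpha r k v0.

(* The upper limit w(x) of the header is at most c as soon as this holds for some
   eta > 0; eta controls both the distance to x and, through eta^-1, the ranks. *)
Definition loc_gap (c eta : R) x : Prop := forall k l y y', K y -> K y' ->
  eta^-1 <= k%:R -> eta^-1 <= l%:R -> `|x - y| < eta -> `|x - y'| < eta ->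
  U k y - V l y' <= c.

Definition unif_gap (c : R) : Prop := exists2 eta : R, 0 < eta &
  forall x, K x -> loc_gap c eta x.

Lemma loc_gap_mono (c c' eta eta' : R) x : 0 < eta' -> eta' <= eta -> c <= c' ->
  loc_gap c eta x -> loc_gap c' eta' x.
Proof.
move=> e'0 ee cc W k l y y' Ky Ky' k1 l1 xy xy'; apply: (le_trans _ cc).
have ei : eta^-1 <= eta'^-1 by rewrite lef_pV2 ?posrE // (lt_le_trans e'0).
by apply: W => //; [exact: le_trans k1|exact: le_trans l1
  |exact: lt_le_trans ee|exact: lt_le_trans ee].
Qed.

Lemma loc_gap_near (c eta : R) x x' : 0 < eta -> `|x - x'| < eta / 2 ->
  loc_gap c eta x -> loc_gap c (eta / 2) x'.
Proof.
move=> e0 xx' W k l y y' Ky Ky' k1 l1 xy xy'.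
have ei : eta^-1 <= (eta / 2)^-1.
  by rewrite lef_pV2 ?posrE ?divr_gt0 // ler_pdivrMr // ler_peMr ?ler1n // ltW.
have tri p : `|x' - p| < eta / 2 -> `|x - p| < eta.
  move=> x'p; rewrite (splitr eta) -(subrK x' x) -addrA.
  by rewrite (le_lt_trans (ler_normD _ _)) // ltrD.
by apply: W => //; [exact: le_trans k1|exact: le_trans l1|exact: tri|exact: tri].
Qed.

(* The points x where w(x) >= m. *)
Definition contact (m : R) : set 'rV[R]_d :=
  [set x | forall eta, 0 < eta -> ~ loc_gap (m - eta) eta x].

(** Upper semicontinuity of w: a local gap at [x] persists, with [eta] halved, at all points within
    [eta / 2]. *)
Lemma contact_closed m : closed (contact m).
Proof.
rewrite -[contact m]setCK; apply: open_closedC; rewrite openE => x /= nx.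
have [eta [e0 W]] : exists eta, 0 < eta /\ loc_gap (m - eta) eta x.
  apply: contrapT => Hn; apply: nx => eta e0 W; apply: Hn; by exists eta.
apply/nbhs_ballP; exists (eta / 2); first by rewrite /= divr_gt0.
move=> x'; rewrite -ball_normE /= => xx' /(_ (eta / 2)); apply.
  by rewrite divr_gt0.
apply: (@loc_gap_mono (m - eta) _ (eta / 2)) => //.
- by rewrite divr_gt0.
- lra.
- exact: loc_gap_near xx' W.
Qed.

Lemma contact_nonempty m : 0 < m -> (forall c, 0 <= c < m -> ~ unif_gap c) ->
  K `&` contact m !=set0.
Proof.
move=> m0 nG; apply: contrapT => nE.
have Pl x : K x -> exists2 eta, 0 < eta & loc_gap (m - eta) eta x.
  move=> Kx; apply: contrapT => Hn; apply: nE; exists x; split => // eta e0 W.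
  by apply: Hn; exists eta.
have [|x Kx|c c0 cP] := @compact_uniform _ _ K
  (fun c x => 0 < c -> loc_gap (m - c) c x) cK.
- move=> c c' x cc' Pc c'0; apply: loc_gap_mono (Pc (lt_le_trans c'0 cc')) => //.
  lra.
- have [eta e0 W] := Pl x Kx; exists (eta / 2); first by rewrite divr_gt0.
  apply/nbhs_ballP; exists (eta / 2); first by rewrite /= divr_gt0.
  move=> x'; rewrite -ball_normE /= => xx' _ _.
  apply: (@loc_gap_mono (m - eta) _ (eta / 2)) => //; last exact: loc_gap_near xx' W.
    by rewrite divr_gt0.
  lra.
(* Capping by [m] keeps [m - c'] nonnegative, the range in which uniform gaps are excluded. *)
pose c' := Num.min c m; have c'0 : 0 < c' by rewrite lt_min c0.
apply: (nG (m - c')); first by rewrite subr_ge0 ge_min lexx orbT /=; lra.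
exists c' => // x Kx; apply: loc_gap_mono (cP x Kx c0) => //.
  by rewrite ge_min lexx.
by rewrite lerD2l lerN2 ge_min lexx.
Qed.

Lemma contact_interior m x : 0 < m -> K x -> contact m x -> O x.
Proof.
move=> m0 Kx Ex; apply: contrapT => nOx.
have bx : bdry O x by apply/(bdryP oO).
have m4 : 0 < m / 4 by rewrite divr_gt0.
have [d1 d10 d1P] := Hiter_boundary uu0 bx m4.
have [d2 d20 d2P] := Hiter_boundary uv0 bx m4.
pose eta := Num.min (Num.min d1 d2) (m / 2).
apply: (Ex eta); first by rewrite !lt_min d10 d20 divr_gt0.
move=> k l y y' Ky Ky' _ _; rewrite !lt_min => /andP[/andP[y1 _] _].
move=> /andP[/andP[_ y2] _].
have em : eta <= m / 2 by rewrite /eta ge_min lexx orbT.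
have := d1P k y Ky y1; have := d2P l y' Ky' y2; rewrite (uv_bdry bx) !ler_norml.
rewrite -/(U k) -/(V l); lra.
Qed.

(** A gap [m - eta] near [probe x z0] would enter the averages at all points near [x] and push the
    next iterates below [m] there, so [x] would not be a contact point. *)
Lemma contact_improve m x : 0 < m -> (forall e, 0 < e -> unif_gap (m + e)) ->
  O x -> contact m x -> forall z, Z z -> contact m (probe x z).
Proof.
move=> m0 G Ox Ex z0 Zz0 eta e0 W; have Kx : K x := subset_closure Ox.
have rx0 : 0 < rad x by rewrite rad_in //; case: (r_adm Ox).
(* In the scale of the unit ball, this is the radius [eta / 2] around [probe x z0]. *)
have q0 : 0 < eta / 2 / rad x by rewrite !divr_gt0.
have [kappa k0 kP] := towmean_gap alpha0 alpha1 Zz0 q0.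
(* One application of H lowers the bound [m + e] by [(eta + e) * kappa / 2], which exceeds [2 * e];
   less than [m - e] remains. *)
pose e := eta * kappa / 4; have ee0 : 0 < e by rewrite divr_gt0 // mulr_gt0.
have [eta' e'0 G'] := G e ee0.
pose eta2 := Num.min eta eta'; have e20 : 0 < eta2 by rewrite lt_min e0.
have e2a : eta2 <= eta by rewrite ge_min lexx.
have e2b : eta2 <= eta' by rewrite ge_min lexx orbT.
have D0 : 0 < 1 + d%:R :> R by rewrite ltr_pwDl.
(* [a1] leaves room for passing to the preceding ranks, and [a2] keeps probes from [x] and from
   nearby points within [eta2 / 2] of each other. *)
pose a1 := (eta2^-1 + 1)^-1; pose a2 := eta2 / 2 / (1 + d%:R).
have a10 : 0 < a1 by rewrite invr_gt0 addr_gt0 // invr_gt0.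
have a20 : 0 < a2 by rewrite !divr_gt0.
pose eta1 := Num.min (Num.min a1 a2) e.
have e10 : 0 < eta1 by rewrite !lt_min a10 a20.
apply: (Ex eta1 e10) => k l y y' Ky Ky' k1 l1 xy xy'.
have e1a : eta1 <= a1 by rewrite /eta1 !ge_min lexx.
have e1b : eta1 <= a2 by rewrite /eta1 !ge_min lexx orbT.
have e1c : eta1 <= e by rewrite /eta1 !ge_min lexx orbT.
have lower j : eta1^-1 <= j%:R -> exists2 j', j = j'.+1 & eta2^-1 <= j'%:R.
  have : eta2^-1 + 1 <= eta1^-1 by rewrite -[leLHS]invrK lef_pV2.
  move=> h1 h2; have h3 := le_trans h1 h2.
  case: j h2 h3 => [|j] _.
    have i0 : 0 < eta2^-1 by rewrite invr_gt0.
    lra.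
  by rewrite -natr1 lerD2r => h3; exists j.
have [k' -> k2] := lower k k1; have [l' -> l2] := lower l l1.
have eta_inv (a : R) : eta2 <= a -> a^-1 <= eta2^-1.
  by move=> ea; rewrite lef_pV2 ?posrE // (lt_le_trans e20).
have near p z : K p -> Z z -> `|x - p| < eta1 ->
    `|probe x z - probe p z| < eta2 / 2.
  move=> Kp Zz xp; rewrite (le_lt_trans (probe_lip Kx Kp Zz)) // mulrC.
  by rewrite -ltr_pdivlMr // (lt_le_trans xp).
have e22 : eta2 / 2 <= eta2 by rewrite ler_pdivrMr // ler_peMr ?ler1n // ltW.
have gap : forall z, Z z -> U k' (probe y z) <= V l' (probe y' z) + (m + e).
  move=> z Zz; rewrite -lerBlDl.
  apply: (G' (probe x z) (probe_closure Kx Zz)).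
  - exact: probe_closure.
  - exact: probe_closure.
  - exact: le_trans (eta_inv _ e2b) k2.
  - exact: le_trans (eta_inv _ e2b) l2.
  - by rewrite (lt_le_trans (near y z Ky Zz xy)) // (le_trans e22).
  - by rewrite (lt_le_trans (near y' z Ky' Zz xy')) // (le_trans e22).
have gap0 : U k' y <= V l' y' + (m + e).
  have e12 : eta1 <= eta2.
    rewrite (le_trans e1b) // (le_trans _ e22) // ler_pdivrMr //.
    by rewrite ler_peMr ?lerDl // divr_ge0 // ltW.
  rewrite -lerBlDl; apply: (G' x Kx) => //.
  - exact: le_trans (eta_inv _ e2b) k2.
  - exact: le_trans (eta_inv _ e2b) l2.
  - by rewrite (lt_le_trans xy) // (le_trans e12).
  - by rewrite (lt_le_trans xy') // (le_trans e12).
have gap1 : forall z, Z z -> `|z - z0| < eta / 2 / rad x ->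
    U k' (probe y z) <= V l' (probe y' z) + (m + e) - (eta + e).
  move=> z Zz; rewrite ltr_pdivlMr // mulrC -probe_dist distrC => zz0.
  have tri p : K p -> `|x - p| < eta1 -> `|probe x z0 - probe p z| < eta.
    move=> Kp xp; rewrite (splitr eta) -(subrK (probe x z) (probe x z0)) -addrA.
    rewrite (le_lt_trans (ler_normD _ _)) // ltrD // (lt_le_trans (near p z Kp Zz xp)) //.
    by rewrite ler_pM2r // invr_gt0.
  have : U k' (probe y z) - V l' (probe y' z) <= m - eta.
    apply: W; [exact: probe_closure|exact: probe_closure| | |exact: tri|exact: tri].
    - exact: le_trans (eta_inv _ e2a) k2.
    - exact: le_trans (eta_inv _ e2a) l2.
  lra.
have uU := Hiter_ucont k' uu0; have uV := Hiter_ucont l' uv0.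
have s0 : 0 <= eta + e by rewrite addr_ge0 // ltW.
have := kP _ _ _ _ (bcont_probe uU Ky) (bcont_probe uV Ky') s0 gap gap1.
rewrite /U /V /Hiter !iterS !HopE // -/(Hiter O alpha r k' u0) -/(Hiter O alpha r l' v0).
move: gap0; rewrite /U /V.
have : e * 4 = eta * kappa by rewrite /e divfK.
have : 0 < e * kappa by rewrite mulr_gt0.
lra.
Qed.

Lemma unif_gap_bound : exists2 c, 0 <= c & unif_gap c.
Proof.
have [B B0 uB] := Hiter_bounded uu0; have [C C0 vC] := Hiter_bounded uv0.
exists (B + C); first by rewrite addr_ge0 // ltW.
exists 1 => // x _ k l y y' Ky Ky' _ _ _ _.
by have := uB k y Ky; have := vC l y' Ky'; rewrite !ler_norml /U /V; lra.
Qed.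

Lemma unif_gap_small e : 0 < e -> unif_gap e.
Proof.
(* The infimum of [S] is the maximum of w, cut off below at 0. *)
pose S := [set c | 0 <= c /\ unif_gap c].
have [c0 c00 Gc0] := unif_gap_bound.
have hS : has_inf S by split; [exists c0|exists 0 => c []].
have G eps : 0 < eps -> unif_gap (inf S + eps).
  move=> eps0; have [c [_ [eta eta0 W]] cS] := inf_adherent eps0 hS.
  exists eta => // x Kx; apply: loc_gap_mono (W x Kx) => //.
  exact: ltW.
have m0 : 0 <= inf S by apply: lb_le_inf; [exists c0|move=> c []].
move=> e0; have [m_le0|m_gt0] := leP (inf S) 0.
  have -> : e = inf S + e by have -> : inf S = 0 by [lra|]; rewrite add0r.
  exact: G.
exfalso.
have nG c : 0 <= c < inf S -> ~ unif_gap c.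
  move=> /andP[c_ge0 cS] Gc; have : inf S <= c by apply: ge_inf => //; case: hS.
  lra.
pose i0 : 'I_d := Ordinal d_gt0.
have cE : compact (K `&` contact (inf S)).
  apply: (subclosed_compact _ cK); last exact: subIsetl.
  by apply: closedI; [exact: closed_closure|exact: contact_closed].
have [x /set_mem[Kx Ex] xmax] : exists2 x, x \in K `&` contact (inf S) &
    forall y, y \in K `&` contact (inf S) -> y ord0 i0 <= x ord0 i0.
  apply: (@EVT_max_rV R d (fun x => x ord0 i0)) => //.
    exact: contact_nonempty.
  exact/continuous_subspaceT/coord_continuous.
have Ox := contact_interior m_gt0 Kx Ex.
(* Half a coordinate vector lies in the open unit ball, and probing along it increases the
   coordinate [i0] by [rad x / 2], against the maximality of [x]. *)
pose z : 'rV[R]_d := 2^-1 *: delta_mx ord0 i0.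
have Zz : Z z.
  rewrite /eball /= subr0 enormZ ger0_norm ?invr_ge0 //.
  have -> : enorm (delta_mx ord0 i0 : 'rV[R]_d) = 1.
    rewrite /enorm (bigD1 i0) //= big1 ?addr0; last first.
      by move=> i ii0; rewrite mxE eqxx (negbTE ii0) expr0n.
    by rewrite mxE !eqxx expr1n sqrtr1.
  by rewrite mulr1 invf_lt1 // ltr1n.
have := xmax _ (mem_set (conj (probe_closure Kx Zz) (contact_improve m_gt0 G Ox Ex Zz))).
rewrite /probe /z !mxE !eqxx mulr1.
have : 0 < rad x by rewrite rad_in //; case: (r_adm Ox).
lra.
Qed.

(** The ranks [k] and [l] are independent, so merging an orbit with itself is the uniform Cauchy
    property. *)
Lemma merging e : 0 < e -> exists N : nat, forall k l x, (N <= k)%N -> (N <= l)%N ->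
  K x -> Hiter O alpha r k u0 x - Hiter O alpha r l v0 x <= e.
Proof.
move=> e0; have [eta eta0 W] := unif_gap_small e0.
exists (Num.trunc eta^-1).+1 => k l x Nk Nl Kx.
have large j : (Num.trunc eta^-1 < j)%N -> eta^-1 <= j%:R.
  by move=> h; apply/ltW/(lt_le_trans (truncnS_gt _)); rewrite ler_nat.
by apply: (W x Kx) => //; rewrite ?large // subrr normr0.
Qed.

End Merging.
End Operator.

(** * Existence of solutions as limits of orbits *)

Section DirichletProblem.
Context {R : realType} {d : nat}.
Variables (O : set 'rV[R]_d) (alpha : R) (r : 'rV[R]_d -> R).
Hypotheses (d_gt0 : (0 < d)%N) (oO : open O) (O0 : O !=set0) (bO : ebounded O)
  (scO : strictly_convex O) (alpha0 : 0 <= alpha) (alpha1 : alpha < 1)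
  (r_adm : forall x, O x -> 0 < r x /\ r x <= dist_to (bdry O) x)
  (r_lip : forall x y, O x -> O y -> `|r x - r y| <= enorm (x - y)).
Local Notation K := (closure O).
Local Notation H := (Hop O alpha r).
Local Notation Hk := (Hiter O alpha r).
Implicit Types (f u v : 'rV[R]_d -> R).

Lemma Hiter_out k u x : ~ O x -> Hk k u x = u x.
Proof. by move=> nOx; elim: k => //= k IH; rewrite /Hop memNset. Qed.

Lemma Hop_fixed u : (forall x, K x -> H u x = u x) <->
  (forall x, O x -> Top alpha r u x = u x).
Proof.
split => fix_u x.
  move=> Ox; have := fix_u x (subset_closure Ox).
  by rewrite /Hop mem_set //; lra.
move=> _; rewrite /Hop; case: ifPn => // /set_mem Ox.
by rewrite fix_u //; field.
Qed.

Lemma Hiter_fixed k u : ucont K u -> (forall x, K x -> H u x = u x) ->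
  forall x, K x -> Hk k u x = u x.
Proof.
move=> uu fix_u; elim: k => // k IH x Kx.
have uk : ucont K (Hk k u) by exact: Hiter_ucont.
(* The two functions are only known to agree on the closure, so comparison in both directions
   replaces rewriting. *)
have le1 : H (Hk k u) x <= H u x + 0.
  by apply: Hop_le => // y Ky; rewrite addr0 IH.
have le2 : H u x <= H (Hk k u) x + 0.
  by apply: Hop_le => // y Ky; rewrite addr0 IH.
rewrite addr0 in le1; rewrite addr0 in le2.
by rewrite -[RHS]fix_u //; apply/eqP; rewrite eq_le le1.
Qed.

Lemma merging_abs u v : ucont K u -> ucont K v ->
  (forall x, bdry O x -> u x = v x) -> forall e, 0 < e ->
  exists N : nat, forall k l x, (N <= k)%N -> (N <= l)%N -> K x ->
    `|Hk k u x - Hk l v x| <= e.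
Proof.
move=> uu uv uvE e e0.
have [N1 N1P] := merging d_gt0 oO O0 bO scO alpha0 alpha1 r_adm r_lip uu uv uvE e0.
have vuE x : bdry O x -> v x = u x by move=> /uvE.
have [N2 N2P] := merging d_gt0 oO O0 bO scO alpha0 alpha1 r_adm r_lip uv uu vuE e0.
exists (maxn N1 N2) => k l x; rewrite !geq_max => /andP[k1 k2] /andP[l1 l2] Kx.
have := N1P k l x k1 l1 Kx; have := N2P l k x l2 k2 Kx.
by rewrite ler_norml; lra.
Qed.

Lemma ucont_limit (U : nat -> 'rV[R]_d -> R) : (forall k, ucont K (U k)) ->
  (forall e, 0 < e -> exists N : nat, forall k l x, (N <= k)%N -> (N <= l)%N ->
    K x -> `|U k x - U l x| <= e) ->
  exists2 u, ucont K u & forall e : R, 0 < e ->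
    exists N : nat, forall k (x : 'rV[R]_d), (N <= k)%N -> K x -> `|U k x - u x| <= e.
Proof.
move=> uU cU; pose u x := lim (U k x @[k --> \oo]).
have cvgU x : K x -> U k x @[k --> \oo] --> u x.
  move=> Kx; apply: (@cauchy_cvg R); apply: cauchy_exP => e e0.
  have e20 : 0 < e / 2 by rewrite divr_gt0.
  have [N NP] := cU _ e20; exists (U N x); exists N => // k /= Nk.
  rewrite -ball_normE /= (le_lt_trans (NP N k x _ _ _)) //.
  by rewrite ltr_pdivrMr // ltr_pMr // ltr1n.
have unif e : 0 < e -> exists N : nat, forall k x, (N <= k)%N -> K x -> `|U k x - u x| <= e.
  move=> e0; have [N NP] := cU e e0; exists N => k x Nk Kx.
  apply/ler_addgt0Pr => eps eps0.
  have /cvgrPdist_lt/(_ eps eps0)[M _ MP] := cvgU x Kx.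
  have := MP (maxn N M) (leq_maxr _ _).
  have := NP k (maxn N M) x Nk (leq_maxl _ _) Kx.
  rewrite !ler_norml /= ltr_norml; lra.
exists u => // e e0; have e40 : 0 < e / 4 by rewrite divr_gt0.
have [N NP] := unif _ e40; have [del del0 delP] := uU N _ e40.
exists del => // x y Kx Ky xy; have := delP x y Kx Ky xy.
have := NP N x (leqnn _) Kx; have := NP N y (leqnn _) Ky.
by rewrite !ler_norml !ltr_norml; lra.
Qed.

(** Tietze extension from the compact boundary, where [f] is bounded. *)
Lemma continuous_extension f : {within bdry O, continuous f} ->
  exists2 g, ucont K g & forall x, bdry O x -> g x = f x.
Proof.
move=> cf; have clb : closed (bdry O).
  rewrite /bdry (interior_id O).1 // setDE; apply: closedI.
    exact: closed_closure.
  exact: open_closedC.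
have cb : compact (bdry O).
  apply: (subclosed_compact clb (closure_compact bO)).
  by move=> x [].
have [B B0 fB] := ucont_bounded cb (within_ucont cb cf).
have [g [gf cg _]] := @continuous_bounded_extension _ R
  (@pseudometric_normal R 'rV[R]_d) _ clb f B B0 cf fB.
exists g; last by move=> x bx; rewrite -gf // mem_set.
by apply: (within_ucont (closure_compact bO)); exact: continuous_subspaceT.
Qed.

(** The orbit of any extension of [f] converges uniformly. The limit is fixed because H is
    non-expansive, and it keeps the boundary values, which no iterate changes. *)
Lemma dirichlet_solution f : {within bdry O, continuous f} ->
  exists u : 'rV[R]_d -> R, [/\ ucont K u, forall x, K x -> H u x = u x
    & forall x, bdry O x -> u x = f x].
Proof.
move=> cf; have [g ug gf] := continuous_extension cf.
have uU k : ucont K (Hk k g) by exact: Hiter_ucont.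
have [u uu uP] := ucont_limit uU (merging_abs ug ug (fun _ _ => erefl)).
exists u; split => // x.
  move=> Kx; apply/eqP; rewrite -subr_eq0 -normr_le0.
  apply/ler_addgt0Pr => e e0; rewrite add0r.
  have e20 : 0 < e / 2 by rewrite divr_gt0.
  have [N NP] := uP _ e20.
  have lo : H (Hk N g) x <= H u x + e / 2.
    apply: Hop_le => // y Ky; have := NP N y (leqnn _) Ky.
    by rewrite ler_norml; lra.
  have up : H u x <= H (Hk N g) x + e / 2.
    apply: Hop_le => // y Ky; have := NP N y (leqnn _) Ky.
    by rewrite ler_norml; lra.
  have := NP N.+1 x (leqnSn _) Kx; rewrite -[Hk N.+1 g x]/(H (Hk N g) x).
  by rewrite !ler_norml; lra.
move=> bx; have [Kx nOx] := (bdryP oO x).1 bx; rewrite -gf //.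
apply/eqP; rewrite -subr_eq0 -normr_le0.
apply/ler_addgt0Pr => e e0; rewrite add0r.
have [N NP] := uP _ e0; have := NP N x (leqnn _) Kx.
by rewrite Hiter_out // distrC.
Qed.

End DirichletProblem.
Theorem theorem1 (R : realType) (d : nat) (O : set 'rV[R]_d)
  (alpha eps lambda beta : R) (r : 'rV[R]_d -> R) :
  (0 < d)%N ->
  is_domain O -> ebounded O -> strictly_convex O ->
  0 <= alpha -> alpha < 1 -> 0 < eps -> eps < 1 - alpha ->
  1 <= beta ->
  (0 < alpha -> beta < ln (1 / alpha) / ln (1 / (1 - eps))) ->
  0 < lambda ->
  lambda < Num.min eps (1 / beta) * (2 / diam O) `^ (beta - 1) ->
  (forall x, O x -> 0 < r x /\ r x <= dist_to (bdry O) x) ->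
  (forall x y, O x -> O y -> `|r x - r y| <= enorm (x - y)) ->
  (forall x, O x -> lambda * dist_to (bdry O) x `^ beta <= r x /\
                    r x <= eps * dist_to (bdry O) x) ->
  forall f : 'rV[R]_d -> R, {within bdry O, continuous f} ->
  exists u : 'rV[R]_d -> R,
    solves O alpha r f u /\
    (forall v, solves O alpha r f v -> forall x, closure O x -> v x = u x) /\
    (forall u0 : 'rV[R]_d -> R,
       {within closure O, continuous u0} ->
       (forall x, bdry O x -> u0 x = f x) ->
       forall e : R, 0 < e -> exists N : nat, forall k : nat, (N <= k)%N ->
         forall x, closure O x -> `|Hiter O alpha r k u0 x - u x| < e).
Proof.
move=> d0 [oO [_ O0]] bO scO alpha0 alpha1 _ _ _ _ _ _ r_adm r_lip _ f cf.
have cK := closure_compact bO.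
have [u [uu fix_u uf]] :=
  dirichlet_solution d0 oO O0 bO scO alpha0 alpha1 r_adm r_lip cf.
have conv u0 : ucont (closure O) u0 -> (forall x, bdry O x -> u0 x = f x) ->
    forall e : R, 0 < e -> exists N : nat, forall k : nat, (N <= k)%N ->
      forall x, closure O x -> `|Hiter O alpha r k u0 x - u x| < e.
  move=> uu0 u0f e e0; have e20 : 0 < e / 2 by rewrite divr_gt0.
  have u0u x : bdry O x -> u0 x = u x by move=> bx; rewrite u0f // uf.
  (* The second orbit is that of the solution, which is constant on the closure. *)
  have [N NP] := merging_abs d0 oO O0 bO scO alpha0 alpha1 r_adm r_lip uu0 uu u0u e20.
  exists N => k Nk x Kx; have := NP k N x Nk (leqnn _) Kx.
  have -> : Hiter O alpha r N u x = u x by exact: Hiter_fixed.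
  by move=> /le_lt_trans; apply; rewrite ltr_pdivrMr // ltr_pMr // ltr1n.
exists u; split; [|split].
- by split; [exact: ucont_within|split => //; exact/(Hop_fixed O)].
- move=> v [cv [vT vf]] x Kx; have uv := within_ucont cK cv.
  have fix_v := (Hop_fixed O alpha r v).2 vT.
  apply/eqP; rewrite -subr_eq0 -normr_le0.
  apply/ler_addgt0Pr => e e0; rewrite add0r.
  (* A second solution is itself an extension of [f] with constant orbit, so convergence gives
     uniqueness. *)
  have [N NP] := conv v uv vf e e0.
  have <- : Hiter O alpha r N v x = v x by exact: Hiter_fixed.
  exact/ltW/NP.
- by move=> u0 cu0; apply: conv; exact: within_ucont.
Qed.
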